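(* Let $H$ be a complex Hilbert space and let $T\in B(H)$ with $\sigma(T)\subset\overline{\mathbb{D}}$. The following assertions are equivalent: (i) $T$ is power-bounded; (ii) there is a constant $C>0$ such that for all $r>1$, $$(r^2-1)\int_0^{2\pi}\|R(re^{it},T)x\|^2\,dt\le C\|x\|^2\quad(x\in H),$$ $$(r^2-1)\int_0^{2\pi}\|R(re^{it},T)^*y\|^2\,dt\le C\|y\|^2\quad(y\in H);$$ (iii) $T$ is a GFS operator.
   Context: $\overline{\mathbb{D}}$ is the closed unit disc, $\sigma(T)$ the spectrum of $T$, $R(\lambda,T)=(\lambda I-T)^{-1}$. $T$ is power-bounded if $\sup_{n\ge1}\|T^n\|<\infty$. Let $X$ be a Banach space, $T\in B(X)$ and $m\ge1$ an integer. $T$ has property $(GFS)_m$ if $\sigma(T)\subset\overline{\mathbb{D}}$ and there is $C>0$ such that for all $r>1$, $x\in X$, $x^*\in X^*$, $\int_0^{2\pi}|\langle R(re^{it},T)^{m+1}x,x^*\rangle|\,dt\le\frac{C}{(r+1)(r-1)^m}\|x\|\|x^*\|$. If $\sigma(T)\subset\overline{\mathbb{D}}$, $T$ has $m$-derivative bounded functional calculus if there is $C>0$ with $\|\phi^{(m)}(T)\|\le\frac{C}{(r-1)^m}\sup_{z\in r\mathbb{D}}|\phi(z)|$ for all $r>1$ and all bounded analytic $\phi:r\mathbb{D}\to\mathbb{C}$, where $r\mathbb{D}$ is the open disc of radius $r$ centred at $0$ and $\phi^{(m)}(T)$ is defined by the Riesz–Dunford calculus. For every $m\ge1$, the following are equivalent: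 $(GFS)_m$; $1$-derivative bounded functional calculus; $m$-derivative bounded functional calculus. $T$ is called a GFS operator if it satisfies one (hence all) of these conditions; in particular $T$ is a GFS operator if and only if it has $(GFS)_1$. *)

(* Defs.v *)
From mathcomp Require Import all_boot all_order all_algebra.
From mathcomp Require Import all_classical all_reals all_analysis.
From mathcomp Require Export complex.

Set Implicit Arguments.
Unset Strict Implicit.
Unset Printing Implicit Defensive.

Import Order.TTheory GRing.Theory Num.Theory.
Import numFieldNormedType.Exports.

Local Open Scope classical_set_scope.
Local Open Scope ring_scope.
Local Open Scope complex_scope.

(* The norm of a [normedModType R[i]] takes its values in [R[i]] (with zero
   imaginary part); [rnorm] is the same norm as an element of [R]. *)
Definition rnorm (R : realType) (X : normedModType R[i]) (x : X) : R :=
  complex.Re `|x|.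

Definition bounded_operator (R : realType) (X Y : normedModType R[i])
    (f : X -> Y) : Prop :=
  linear f /\ continuous f.

(* [bounded_functional f] says that [f] is in the topological dual of [X];
   [R[i]^o] is [R[i]] as a normed module over itself. *)
Definition bounded_functional (R : realType) (X : normedModType R[i])
    (f : X -> R[i]^o) : Prop :=
  bounded_operator f.

Definition opnorm (R : realType) (X Y : normedModType R[i]) (f : X -> Y) : R :=
  sup [set rnorm (f x) | x in [set x : X | rnorm x <= 1]].

Definition power_bounded (R : realType) (X : normedModType R[i])
    (T : X -> X) : Prop :=
  (ereal_sup [set (opnorm (iter n T))%:E | n in [set n | (1 <= n)%N]] < +oo)%E.

Definition is_resolvent (R : realType) (X : normedModType R[i])
    (T : X -> X) (lambda : R[i]) (S : X -> X) : Prop :=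
  [/\ bounded_operator S,
      (forall x, S (lambda *: x - T x) = x) &
      (forall x, lambda *: S x - T (S x) = x)].

Definition spectrum (R : realType) (X : normedModType R[i])
    (T : X -> X) : set R[i] :=
  [set lambda | ~ exists S, is_resolvent T lambda S].

(* R(lambda, T); the default value 0 is only taken on the spectrum of [T]. *)
Definition resolvent (R : realType) (X : normedModType R[i])
    (lambda : R[i]) (T : X -> X) : X -> X :=
  xget (fun=> 0) [set S | is_resolvent T lambda S].

Definition closed_unit_disc (R : realType) : set R[i] :=
  [set z | `|z| <= 1].
Arguments closed_unit_disc R : clear implicits.

(* r e^{it} *)
Definition polar (R : realType) (r t : R) : R[i] := (r * cos t) +i* (r * sin t).

(* Property (GFS)_m; meant for m >= 1. *)
Definition GFS (R : realType) (X : completeNormedModType R[i]) (m : nat)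
    (T : X -> X) : Prop :=
  spectrum T `<=` closed_unit_disc R /\
  exists2 C : R, 0 < C &
    forall r : R, 1 < r ->
    forall (x : X) (f : X -> R[i]^o), bounded_functional f ->
      (\int[lebesgue_measure]_(t in `[0%R, (2 * pi)%R])
          (rnorm (f (iter m.+1 (resolvent (polar r t) T) x)))%:E <=
       (C / ((r + 1) * (r - 1) ^+ m) * rnorm x * opnorm f)%:E)%E.

(* The properties (GFS)_m, m >= 1, are equivalent to one another; (GFS)_1 is
   the one taken as the definition. *)
Definition GFS_operator (R : realType) (X : completeNormedModType R[i])
    (T : X -> X) : Prop :=
  GFS 1 T.

(* [dot] is an inner product (linear in its first argument) inducing the norm
   of [H], which makes the complete space [H] a Hilbert space. *)
Definition hilbert_dot (R : realType) (H : completeNormedModType R[i])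
    (dot : {dot H for Num.conj}) : Prop :=
  forall x : H, `|x| ^+ 2 = dot x x.

(* The Hilbert space adjoint of [A]; by the Riesz representation theorem the
   default value 0 is not taken when [A] is a bounded operator. *)
Definition adjoint (R : realType) (H : completeNormedModType R[i])
    (dot : {dot H for Num.conj}) (A : H -> H) : H -> H :=
  xget (fun=> 0)
    [set B | bounded_operator B /\ forall x y, dot (A x) y = dot x (B y)].

(* Main.v *)
(* (i) => (ii): the Neumann series of R(re^{it}, T)x is a Fourier series in t, so
   by Parseval its square mean is the sum of the |T^n x|^2 / r^(2n+2); the adjoint
   R(re^{it}, T)^* y is treated in the same way, with T^* and the conjugate circle.
   (ii) => (iii): <R^2 x, y> = <R x, R^* y>, and Cauchy-Schwarz.
   (iii) => (i): (n + 1) r^(-n-2) <T^n x, y> is a Fourier coefficient of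
   <R(re^{it}, T)^2 x, y>; take y = T^n x and r = 1 + 1/(n+1).

   In the last step the expansion of R^2 must be valid for every r > 1, while only
   the inclusion of the spectrum in the closed disc is known.  Following Rickart,
   the mean of z R(z, T) over the N-th roots z of rho^N is the inverse of
   1 - T^N / rho^N, and it varies with rho uniformly in N; so the set of all rho > 1
   for which T^N / rho^N is bounded in N has infimum 1. *)

Require Import Defs.
From HB Require Import structures.
From mathcomp Require Import all_boot all_order all_algebra.
From mathcomp Require Import all_classical all_reals all_analysis.
From mathcomp Require Import ring lra.

Set Implicit Arguments.
Unset Strict Implicit.
Unset Printing Implicit Defensive.

Import Order.TTheory GRing.Theory Num.Theory.
Import numFieldNormedType.Exports.

Local Open Scope classical_set_scope.
Local Open Scope ring_scope.
Local Open Scope complex_scope.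

(** * Norms and bounded operators *)

Section Rnorm.
Variable R : realType.
Implicit Type X : normedModType R[i].

(** No infinite series occurs. Each Neumann series is cut at [N] with an exact remainder
    [w ^+ N *: iter N T _], the integral is computed for the finite sum, and [N] is chosen last.
    This requires the remainder to vanish uniformly on the circle, hence two bounds: one for the
    resolvent on the whole circle, by compactness, and one for the powers of [T]. From (i) the
    second is given; from (iii) it is not, and that gap is what the averaging over roots of unity
    fills. The averages use only finite geometric sums and the resolvent identity, so no
    operator-valued integral and no analyticity is involved: every integral below is that of a real
    function on [[0, 2 * pi]].

    The Fourier coefficients are therefore read off real parts, and the norm is used through the
    real-valued [rnorm]. The adjoint is obtained by choice, so it has its meaning only once Riesz
    representation provides an operator to choose. *)

Lemma rnormE X (x : X) : `|x| = (rnorm x)%:C.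
Proof. by rewrite /rnorm RRe_real// normr_real. Qed.

Lemma rnorm_ge0 X (x : X) : 0 <= rnorm x.
Proof. by rewrite -ler0c -rnormE. Qed.

Lemma rnorm0 X : rnorm (0 : X) = 0.
Proof. by rewrite /rnorm normr0. Qed.

Lemma rnorm_eq0 X (x : X) : rnorm x = 0 -> x = 0.
Proof. by move=> x0; apply/normr0_eq0; rewrite rnormE x0. Qed.

Lemma rnormD X (x y : X) : rnorm (x + y) <= rnorm x + rnorm y.
Proof. by rewrite -lecR rmorphD/= -!rnormE ler_normD. Qed.

Lemma rnormN X (x : X) : rnorm (- x) = rnorm x.
Proof. by rewrite /rnorm normrN. Qed.

Lemma rnormB X (x y : X) : rnorm (x - y) <= rnorm x + rnorm y.
Proof. by rewrite (le_trans (rnormD _ _))// rnormN. Qed.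

Lemma rnorm_distC X (x y : X) : rnorm (x - y) = rnorm (y - x).
Proof. by rewrite /rnorm distrC. Qed.

Lemma rnormZ X (a : R[i]) (x : X) : rnorm (a *: x) = rnorm (a : R[i]^o) * rnorm x.
Proof. by apply: complexI; rewrite rmorphM/= -!rnormE normrZ. Qed.

Lemma rnorm_sum X (I : Type) (s : seq I) (F : I -> X) :
  rnorm (\sum_(i <- s) F i) <= \sum_(i <- s) rnorm (F i).
Proof.
elim/big_rec2: _ => [|i y x _ h]; first by rewrite rnorm0.
by rewrite (le_trans (rnormD _ _))// lerD2l.
Qed.

Lemma rnorm_dist_dist X (x y : X) : `|rnorm x - rnorm y| <= rnorm (x - y).
Proof.
rewrite ler_norml; have := rnormD (x - y) y; have := rnormD (y - x) x.
rewrite !subrK (rnorm_distC y x); lra.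
Qed.

Lemma rnormcM (a b : R[i]) : rnorm (a * b : R[i]^o) = rnorm (a : R[i]^o) * rnorm (b : R[i]^o).
Proof. exact: rnormZ. Qed.

Lemma rnormcX (a : R[i]) n : rnorm (a ^+ n : R[i]^o) = rnorm (a : R[i]^o) ^+ n.
Proof.
by apply: complexI; rewrite rmorphXn/= -!rnormE; apply: (@normrX R[i]).
Qed.

Lemma rnorm_real (a : R) : rnorm (a%:C : R[i]^o) = `|a|.
Proof. by rewrite /rnorm normc_def/= expr0n/= addr0 sqrtr_sqr. Qed.

Lemma rnormc_sqr (a : R[i]) : rnorm (a : R[i]^o) ^+ 2 = complex.Re a ^+ 2 + complex.Im a ^+ 2.
Proof. by rewrite /rnorm normc_def/= sqr_sqrtr// addr_ge0 ?sqr_ge0. Qed.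

Lemma Re_le_rnorm (a : R[i]) : complex.Re a <= rnorm (a : R[i]^o).
Proof.
have [h|/ltW h] := lerP (complex.Re a) 0; first exact: le_trans h (rnorm_ge0 _).
by rewrite -(@ler_pXn2r _ 2)// ?nnegrE ?rnorm_ge0// rnormc_sqr lerDl sqr_ge0.
Qed.

(** The order of [R[i]] only compares numbers with equal imaginary parts, so a positive epsilon is
    real. This turns the complex epsilons of the normed topology into real ones. *)
Lemma gt0_complexP (e : R[i]) : 0 < e -> exists2 r : R, 0 < r & e = r%:C.
Proof.
by case: e => a b; rewrite ltcE/= => /andP[/eqP-> a0]; exists a.
Qed.

Lemma rnorm_nbhs X (x : X) (P : set X) : nbhs x P <->
  exists2 e : R, 0 < e & forall y, rnorm (x - y) < e -> P y.
Proof.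
split.
  move=> /nbhs_normP[_ /gt0_complexP[e e0 ->] h]; exists e => // y xy.
  by apply: h; rewrite /= rnormE ltcR.
case=> e e0 h; apply/nbhs_normP; exists e%:C; first by rewrite /= ltcR.
by move=> y /=; rewrite rnormE ltcR; exact: h.
Qed.

End Rnorm.

Section BoundedOperators.
Variable R : realType.
Implicit Types X Y : normedModType R[i].

Section linear_hyp.
Variables (X Y : lmodType R[i]) (f : X -> Y).
Hypothesis lf : linear f.

Lemma linD x y : f (x + y) = f x + f y.
Proof. by have := lf 1 x y; rewrite !scale1r. Qed.

Lemma lin0 : f 0 = 0.
Proof. by have := lf (-1) 0 0; rewrite !scaleN1r oppr0 addr0 addNr. Qed.

Lemma linZ a x : f (a *: x) = a *: f x.
Proof. by have := lf a x 0; rewrite lin0 !addr0. Qed.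

Lemma linN x : f (- x) = - f x.
Proof. by rewrite -[- x]scaleN1r linZ scaleN1r. Qed.

Lemma linB x y : f (x - y) = f x - f y.
Proof. by rewrite linD linN. Qed.

Lemma lin_sum (I : Type) (s : seq I) (F : I -> X) :
  f (\sum_(i <- s) F i) = \sum_(i <- s) f (F i).
Proof.
by elim/big_rec2: _ => [|i y x _ <-]; rewrite ?lin0// linD.
Qed.

End linear_hyp.

Lemma iter_linear (X : lmodType R[i]) (T : X -> X) n : linear T -> linear (iter n T).
Proof. by move=> lT; elim: n => [|n ih] a x y //=; rewrite ih lT. Qed.

Lemma bounded_operatorP X Y (f : X -> Y) : bounded_operator f <->
  linear f /\ exists2 K : R, 0 <= K & forall x, rnorm (f x) <= K * rnorm x.
Proof.
split=> -[lf cf]; split=> //.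
  pose g : {linear X -> Y} := HB.pack f (GRing.isLinear.Build _ _ _ _ f lf).
  have /linear_bounded_continuous/linear_boundedP/pinfty_ex_gt0[_ /gt0_complexP[K K0 ->] h] :
    continuous g by exact: cf.
  exists K; first exact: ltW.
  by move=> x; have := h x; rewrite !rnormE -rmorphM lecR.
case: cf => K K0 h x; apply/(@cvgrPdist_le _ _ _ (nbhs x)) => _ /gt0_complexP[e' e'0 ->].
apply/rnorm_nbhs; exists (e' / (K + 1)); first by rewrite divr_gt0// ltr_wpDl.
move=> y; rewrite ltr_pdivlMr ?ltr_wpDl// => xy.
rewrite -linB// rnormE lecR (le_trans (h _))// (le_trans _ (ltW xy))//.
by rewrite mulrC ler_wpM2l ?rnorm_ge0// lerDl.
Qed.

Lemma opnorm_ub X Y (f : X -> Y) x : bounded_operator f ->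
  rnorm (f x) <= opnorm f * rnorm x.
Proof.
move=> /bounded_operatorP[lf [K K0 h]].
have [x0|x0] := eqVneq (rnorm x) 0.
  by rewrite (rnorm_eq0 x0) lin0// !rnorm0 mulr0.
have xp : 0 < rnorm x by rewrite lt_def x0 rnorm_ge0.
rewrite -ler_pdivrMr//; apply: ub_le_sup.
  exists K => _ [y /= y1 <-]; rewrite (le_trans (h y))//.
  by rewrite ler_piMr.
exists ((rnorm x)^-1%:C *: x) => /=.
  by rewrite rnormZ rnorm_real ger0_norm ?invr_ge0 ?rnorm_ge0// mulVf.
by rewrite linZ// rnormZ rnorm_real ger0_norm ?invr_ge0 ?rnorm_ge0// mulrC.
Qed.

Lemma opnorm_le X Y (f : X -> Y) (K : R) : 0 <= K ->
  (forall x, rnorm (f x) <= K * rnorm x) -> opnorm f <= K.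
Proof.
move=> K0 h; apply: ge_sup.
  by exists (rnorm (f 0)), 0 => //=; rewrite rnorm0.
move=> _ [x /= x1 <-]; rewrite (le_trans (h x))//.
by rewrite ler_piMr.
Qed.

Lemma opnorm_ge0 X Y (f : X -> Y) : bounded_operator f -> 0 <= opnorm f.
Proof.
move=> bf; have [[x x0]|h] := pselect (exists x : X, 0 < rnorm x).
  have := opnorm_ub x bf; rewrite -ler_pdivrMr//; apply: le_trans.
  by rewrite divr_ge0 ?rnorm_ge0.
apply: ub_le_sup.
  exists 0 => _ [y /= y1 <-]; rewrite (le_trans (opnorm_ub y bf))//.
  suff -> : rnorm y = 0 by rewrite mulr0.
  apply/eqP; rewrite eq_le rnorm_ge0 andbT leNgt; apply/negP => y0.
  by apply: h; exists y.
by exists 0 => /=; rewrite ?rnorm0// lin0 ?rnorm0//; case: bf.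
Qed.

Lemma bounded_iter X (T : X -> X) n : bounded_operator T -> bounded_operator (iter n T).
Proof.
move=> [lT cT]; split; first exact: iter_linear.
elim: n => [|n ih] //= x; first exact: cvg_id.
exact: (@continuous_comp _ _ _ (iter n T) T x (ih x) (cT _)).
Qed.

Lemma power_boundedP X (T : X -> X) : bounded_operator T -> power_bounded T <->
  exists2 M : R, 0 <= M & forall n x, rnorm (iter n T x) <= M * rnorm x.
Proof.
move=> bT; rewrite /power_bounded; split.
  move=> h.
  have [M hM] : exists M : R, forall n, (1 <= n)%N -> opnorm (iter n T) <= M.
    move: h; set s := ereal_sup _ => h.
    have hs n : (1 <= n)%N -> ((opnorm (iter n T))%:E <= s)%E.
      by move=> n1; apply: ereal_sup_ubound; exists n.
    move: h hs; case: s => [M _ hs|//|_ hs].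
      by exists M => n /hs; rewrite lee_fin.
    by have := hs 1%N isT; rewrite leeNy_eq.
  (* The supremum in [power_bounded] starts at [n = 1]; the 1 in the maximum covers [n = 0]. *)
  exists (Num.max 1 M); first by rewrite le_max ler01.
  move=> [|n] x; first by rewrite ler_peMl ?rnorm_ge0// le_max lexx.
  rewrite (le_trans (opnorm_ub x (bounded_iter n.+1 bT)))//.
  by rewrite ler_wpM2r ?rnorm_ge0// le_max hM ?orbT.
case=> M M0 h; apply: (@le_lt_trans _ _ M%:E); last by rewrite ltry.
apply: ge_ereal_sup => _ [n _ <-]; rewrite lee_fin.
exact: opnorm_le.
Qed.

End BoundedOperators.

(** * Points of a circle and the resolvent *)

Section Polar.
Variable R : realType.
Implicit Types r s t : R.

Lemma polarM r s r' s' : polar r s * polar r' s' = polar (r * r') (s + s').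
Proof.
by rewrite /polar -[LHS]/(_ +i* _) cosD sinD; congr (_ +i* _); ring.
Qed.

Lemma polar0 r : polar r 0 = r%:C.
Proof. by rewrite /polar cos0 sin0 mulr1 mulr0. Qed.

Lemma polarX r t n : polar r t ^+ n = polar (r ^+ n) (t *+ n).
Proof.
elim: n => [|n ih]; first by rewrite !expr0 mulr0n polar0.
by rewrite !exprS ih polarM mulrS.
Qed.

Lemma polar_real r r' t : r%:C * polar r' t = polar (r * r') t.
Proof. by rewrite -polar0 polarM add0r. Qed.

Lemma rnorm_polar r t : 0 <= r -> rnorm (polar r t : R[i]^o) = r.
Proof.
move=> r0; apply/eqP; rewrite -(@eqrXn2 _ 2)// ?rnorm_ge0//.
by rewrite rnormc_sqr/= !exprMn -mulrDr cos2Dsin2 mulr1.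
Qed.

Lemma polar_2pi : polar 1 (2 * pi : R) = 1.
Proof. by rewrite mulr_natl /polar cos2pi sin2pi mulr1 mulr0. Qed.

Lemma polar_inv r t : r != 0 -> (polar r t)^-1 = polar r^-1 (- t).
Proof.
move=> r0; have h : polar r t * polar r^-1 (- t) = 1.
  by rewrite polarM divff// subrr polar0.
have p0 : polar r t != 0.
  by apply/eqP => p0; move: h; rewrite p0 mul0r => /esym/eqP; rewrite oner_eq0.
by apply: (mulfI p0); rewrite h divff.
Qed.

Lemma rnorm_polarB r r' t : rnorm (polar r t - polar r' t : R[i]^o) = `|r - r'|.
Proof.
have -> : polar r t - polar r' t = (r - r')%:C * polar 1 t.
  by rewrite polar_real mulr1 /polar -[LHS]/(_ +i* _) !mulrBl.
by rewrite rnormcM rnorm_real rnorm_polar// mulr1.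
Qed.

Lemma rnormc_le (a : R[i]) : rnorm (a : R[i]^o) <= `|complex.Re a| + `|complex.Im a|.
Proof.
rewrite -(@ler_pXn2r _ 2)// ?nnegrE ?rnorm_ge0 ?addr_ge0//.
rewrite rnormc_sqr -(real_normK (num_real (complex.Re a))).
rewrite -(real_normK (num_real (complex.Im a))).
have := normr_ge0 (complex.Re a); have := normr_ge0 (complex.Im a); nra.
Qed.

Lemma polar_near r t e : 0 < e ->
  \forall s \near t, rnorm (polar r t - polar r s : R[i]^o) <= e.
Proof.
move=> e0; pose d := e / (2 * (`|r| + 1)).
have r1 : 0 < `|r| + 1 by rewrite ltr_wpDl.
have d0 : 0 < d by rewrite divr_gt0// mulr_gt0.
have hc : \forall s \near t, `|cos t - cos s| <= d.
  by have /cvgrPdist_le := @continuous_cos R t; exact.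
have hs : \forall s \near t, `|sin t - sin s| <= d.
  by have /cvgrPdist_le := @continuous_sin R t; exact.
near=> s.
rewrite (le_trans (rnormc_le _))//= -!mulrBr !normrM.
have h1 : `|cos t - cos s| <= d by near: s.
have h2 : `|sin t - sin s| <= d by near: s.
have -> : e = (`|r| + 1) * d + (`|r| + 1) * d.
  by rewrite /d; field; rewrite lt0r_neq0.
by apply: lerD; apply: ler_pM => //; rewrite lerDl.
Unshelve. all: by end_near. Qed.

(** By the half-angle formula cos t = 1 - 2 sin^2(t/2), and t/2 lies in (0, pi), where the sine is
    positive. *)
Lemma polar1_neq1 t : 0 < t < 2 * pi -> polar 1 t != 1.
Proof.
move=> /andP[t0 t1]; apply/eqP => /(congr1 (@complex.Re R)) /=; rewrite mul1r.
have -> : t = t / 2 + t / 2 by field.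
rewrite cosD -!expr2 cos2sin2 => h.
have : 0 < sin (t / 2) by apply: sin_gt0_pi; rewrite divr_gt0//= ltr_pdivrMr// mulrC.
have : sin (t / 2) ^+ 2 = 0 by move: h; set u := _ ^+ 2; lra.
by move/eqP; rewrite sqrf_eq0 => /eqP ->; rewrite ltxx.
Qed.

Lemma sum_root_powers N m : (0 < m < N)%N ->
  \sum_(k < N) (polar 1 (2 * pi / N%:R : R) ^+ k) ^+ m = 0.
Proof.
move=> /andP[m0 mN]; set w := polar _ _.
have N0 : (0 : R) < N%:R by rewrite ltr0n (leq_trans _ mN).
have wm : w ^+ m != 1.
  rewrite polarX expr1n; apply: polar1_neq1.
  have m0' : (0 : R) < m%:R by rewrite ltr0n.
  have mN' : (m%:R : R) < N%:R by rewrite ltr_nat.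
  have p0 := pi_gt0 R.
  rewrite -[_ *+ m]mulr_natr mulr_gt0 ?divr_gt0 ?mulr_gt0//=.
  by rewrite mulrAC ltr_pdivrMr// ltr_pM2l// mulr_gt0.
apply: (mulfI (_ : w ^+ m - 1 != 0)); first by rewrite subr_eq0.
rewrite mulr0; transitivity ((w ^+ m) ^+ N - 1).
  rewrite [RHS]subrX1; congr (_ * _); apply: eq_bigr => k _.
  by rewrite -!exprM mulnC.
rewrite -exprM mulnC exprM polarX expr1n -[X in polar _ X]mulr_natr divfK ?gt_eqF//.
by rewrite polar_2pi expr1n subrr.
Qed.

End Polar.

Section Resolvent.
Variables (R : realType) (X : normedModType R[i]) (T : X -> X).
Hypotheses (bT : bounded_operator T) (hspec : spectrum T `<=` closed_unit_disc R).
Implicit Types (z w : R[i]) (x : X).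
Local Notation Rs z := (resolvent z T).

Lemma is_resolventP z : 1 < rnorm (z : R[i]^o) -> is_resolvent T z (Rs z).
Proof.
move=> z1; have [S hS] : exists S, is_resolvent T z S.
  apply: contrapT => h; have := hspec h.
  by rewrite /closed_unit_disc/= (rnormE (z : R[i]^o)) lecR leNgt z1.
exact: (@xgetPex _ (fun=> 0) [set S | is_resolvent T z S] (ex_intro _ S hS)).
Qed.

Let lT : linear T := proj1 bT.

Section at_point.
Variable z : R[i].
Hypothesis z1 : 1 < rnorm (z : R[i]^o).

Lemma resolvent_bounded : bounded_operator (Rs z).
Proof. by have [] := is_resolventP z1. Qed.

Lemma resolvent_linear : linear (Rs z).
Proof. by have [[]] := is_resolventP z1. Qed.

Lemma resolventE x : z *: Rs z x = x + T (Rs z x).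
Proof. by apply/eqP; rewrite -subr_eq; have [_ _ ->] := is_resolventP z1. Qed.

Lemma resolvent_comm x : Rs z (T x) = T (Rs z x).
Proof.
have [_ /(_ x) + _] := is_resolventP z1.
rewrite linB; last exact: resolvent_linear.
rewrite linZ; last exact: resolvent_linear.
by rewrite resolventE => /eqP; rewrite -addrA -subr_eq0 addrAC subrr add0r subr_eq0 => /eqP.
Qed.

Lemma resolvent_iter_comm n x : Rs z (iter n T x) = iter n T (Rs z x).
Proof. by elim: n => //= n ih; rewrite resolvent_comm ih. Qed.

(** Telescoping of (z^N - T^N) z (z - T)^-1. At the roots z of z^N = rho^N the operator z^N - T^N is
    the same for all roots, so the identity can be averaged over them. *)
Lemma resolvent_pow N x :
  z ^+ N *: (z *: Rs z x) - iter N T (z *: Rs z x) =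
  \sum_(j < N) z ^+ (N - j) *: iter j T x.
Proof.
set v := z *: Rs z x.
have hv : T v = z *: v - z *: x.
  by rewrite /v linZ// -scalerBr [in RHS]resolventE addrAC subrr add0r.
elim: N => [|N ih]; first by rewrite big_ord0 expr0 scale1r subrr.
rewrite big_ord_recr/= subSnn expr1.
under eq_bigr => j _ do rewrite subSn ?(ltnW (ltn_ord j))// exprS -scalerA.
rewrite -scaler_sumr -ih exprS -scalerA scalerBr -addrA; congr (_ + _).
rewrite -iterS iterSr hv.
have lN := iter_linear N lT.
by rewrite (linB lN) !(linZ lN) opprB addrC.
Qed.

End at_point.

Lemma resolvent_identity z w x :
  1 < rnorm (z : R[i]^o) -> 1 < rnorm (w : R[i]^o) ->
  Rs z x - Rs w x = (w - z) *: Rs z (Rs w x).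
Proof.
move=> z1 w1; set v := Rs w x.
have -> : x = z *: v - T v + (w - z) *: v.
  by rewrite scalerBl addrC subrKA resolventE// addrK.
have lz := resolvent_linear z1; have [_ hz _] := is_resolventP z1.
by rewrite (linD lz) hz (linZ lz) addrC addKr.
Qed.

(** The resolvent identity bounds the difference by [K * rnorm (w - z)] times the unknown
    [rnorm (Rs w x)]; as this factor is at most 1/2, the unknown is absorbed on the left. No prior
    bound at [w] is needed. *)
Lemma resolvent_close z w (K : R) :
  1 < rnorm (z : R[i]^o) -> 1 < rnorm (w : R[i]^o) ->
  (forall x, rnorm (Rs z x) <= K * rnorm x) -> 0 <= K ->
  K * rnorm (w - z : R[i]^o) <= 2^-1 ->
  forall x, rnorm (Rs w x) <= 2 * K * rnorm x /\
    rnorm (Rs z x - Rs w x) <= 2 * K ^+ 2 * rnorm (w - z : R[i]^o) * rnorm x.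
Proof.
move=> z1 w1 hK K0; set d := rnorm _ => hd x.
have d0 : 0 <= d by exact: rnorm_ge0.
have h1 : rnorm (Rs z x - Rs w x) <= d * (K * rnorm (Rs w x)).
  by rewrite resolvent_identity// rnormZ ler_wpM2l.
have h2 : rnorm (Rs w x) <= rnorm (Rs z x) + rnorm (Rs z x - Rs w x).
  by rewrite rnorm_distC -{1}(subrK (Rs z x) (Rs w x)) addrC rnormD.
have h3 := hK x; have a0 := rnorm_ge0 (Rs w x); have x0 := rnorm_ge0 x.
have h4 : d * (K * rnorm (Rs w x)) <= 2^-1 * rnorm (Rs w x).
  by rewrite mulrA [d * K]mulrC ler_wpM2r.
have h5 : rnorm (Rs w x) <= 2 * K * rnorm x by lra.
split=> //; apply: (le_trans h1).
have -> : 2 * K ^+ 2 * d * rnorm x = d * (K * (2 * K * rnorm x)) by ring.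
by rewrite !ler_wpM2l.
Qed.

(** The error is relative to [rnorm x], with one neighbourhood for all [x]: this is continuity in
    operator norm, which passes to [opnorm] and to adjoints. *)
Lemma resolvent_near (r t e : R) : 1 < r -> 0 < e ->
  \forall s \near t, forall x,
    rnorm (Rs (polar r t) x - Rs (polar r s) x) <= e * rnorm x.
Proof.
move=> r1 e0.
have p1 s : 1 < rnorm (polar r s : R[i]^o) by rewrite rnorm_polar// ltW// (lt_trans _ r1).
pose K := opnorm (Rs (polar r t)) + 1.
have hK x : rnorm (Rs (polar r t) x) <= K * rnorm x.
  rewrite (le_trans (opnorm_ub x (resolvent_bounded (p1 t))))//.
  by rewrite ler_wpM2r ?rnorm_ge0// lerDl.
have K0 : 0 < K by rewrite ltr_wpDl// opnorm_ge0//; exact: resolvent_bounded.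
have h1 : 0 < (2 * K)^-1 by rewrite invr_gt0 mulr_gt0.
have h2 : 0 < e / (2 * K ^+ 2) by rewrite divr_gt0// mulr_gt0// exprn_gt0.
near=> s; move=> x.
have c1 : rnorm (polar r t - polar r s : R[i]^o) <= (2 * K)^-1.
  by near: s; exact: polar_near.
have c2 : rnorm (polar r t - polar r s : R[i]^o) <= e / (2 * K ^+ 2).
  by near: s; exact: polar_near.
rewrite (rnorm_distC (polar r t : R[i]^o)) in c1 c2.
have [|_] := resolvent_close (p1 t) (p1 s) hK (ltW K0) _ x.
  rewrite (le_trans (ler_wpM2l (ltW K0) c1))// invfM mulrCA divff ?gt_eqF//.
  by rewrite mulr1.
move=> /le_trans; apply; rewrite ler_wpM2r ?rnorm_ge0//.
by move: c2; rewrite ler_pdivlMr ?mulr_gt0// ?exprn_gt0// mulrC.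
Unshelve. all: by end_near. Qed.

(** The operator norm of the resolvent is continuous in the angle, so it attains its maximum on the
    compact interval. *)
Lemma resolvent_circle_bounded (r : R) : 1 < r -> exists2 K : R, 0 <= K &
  forall t x, t \in `[0, 2 * pi] -> rnorm (Rs (polar r t) x) <= K * rnorm x.
Proof.
move=> r1.
have p1 s : 1 < rnorm (polar r s : R[i]^o) by rewrite rnorm_polar// ltW// (lt_trans _ r1).
pose g s := opnorm (Rs (polar r s)).
have cg : continuous g.
  move=> t; apply/cvgrPdist_le => e e0; near=> s.
  have hs : forall x, rnorm (Rs (polar r t) x - Rs (polar r s) x) <= e * rnorm x.
    by near: s; exact: resolvent_near.
  rewrite ler_distlC; apply/andP; split; last first.
    apply: opnorm_le => [|x]; first by rewrite addr_ge0 ?opnorm_ge0 ?ltW//; exact: resolvent_bounded.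
    rewrite mulrDl -(subrK (Rs (polar r t) x) (Rs (polar r s) x)) addrC.
    rewrite (le_trans (rnormD _ _))// lerD//; last by rewrite rnorm_distC.
    exact: opnorm_ub (resolvent_bounded _).
  rewrite lerBlDr; apply: opnorm_le => [|x].
    by rewrite addr_ge0 ?opnorm_ge0 ?ltW//; exact: resolvent_bounded.
  rewrite mulrDl -(subrK (Rs (polar r s) x) (Rs (polar r t) x)) addrC.
  rewrite (le_trans (rnormD _ _))// lerD//.
  exact: opnorm_ub (resolvent_bounded _).
have [||c _ hc] := @EVT_max R g 0 (2 * pi).
- by rewrite mulr_ge0// pi_ge0.
- exact: continuous_subspaceT.
exists (g c); first by apply: opnorm_ge0; exact: resolvent_bounded.
move=> t x /hc gt; rewrite (le_trans (opnorm_ub x (resolvent_bounded (p1 t))))//.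
by rewrite ler_wpM2r ?rnorm_ge0.
Unshelve. all: by end_near. Qed.

End Resolvent.

(** * The spectral radius by averaging over roots of unity *)

Lemma geometric_small (R : realType) (q e : R) : 0 <= q < 1 -> 0 < e ->
  exists N, forall n, (N <= n)%N -> q ^+ n <= e.
Proof.
move=> /andP[q0 q1] e0.
have /cvgrPdist_le/(_ e e0)[N _ h] : q ^+ n @[n --> \oo] --> 0.
  by apply: cvg_expr; rewrite ger0_norm.
exists N => n Nn; have := h n Nn; rewrite /= sub0r normrN ger0_norm//.
exact: exprn_ge0.
Qed.

Section PowerGrowth.
Variables (R : realType) (X : normedModType R[i]) (T : X -> X).
Hypotheses (bT : bounded_operator T) (hspec : spectrum T `<=` closed_unit_disc R).
Implicit Types (rho sigma : R) (x : X).
Local Notation Rs z := (resolvent z T).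
Let lT : linear T := proj1 bT.

Let node rho N k := polar rho (2 * pi / N%:R *+ k).

(** The Riemann sum with [N] equidistant nodes of the Riesz integral (2 pi i)^-1 \oint R(z, T)x dz
    over the circle of radius [rho], since dz = i z dt. *)
Definition circle_mean rho N x : X :=
  (N%:R^-1 : R)%:C *: \sum_(k < N) node rho N k *: Rs (node rho N k) x.

Let node1 rho N k : 1 < rho -> 1 < rnorm (node rho N k : R[i]^o).
Proof. by move=> r1; rewrite rnorm_polar// ltW// (lt_trans _ r1). Qed.

Let nodeE rho N k : node rho N k = rho%:C * polar 1 (2 * pi / N%:R) ^+ k.
Proof. by rewrite polarX expr1n polar_real mulr1. Qed.

Let node_in N k : (k < N)%N -> (2 * pi / N%:R : R) *+ k \in `[0, 2 * pi].
Proof.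
move=> kN; rewrite in_itv/= -[_ *+ k]mulr_natr.
have N0 : (0 : R) < N%:R by rewrite ltr0n (leq_trans _ kN).
have p0 := pi_ge0 R.
rewrite mulr_ge0 ?divr_ge0 ?mulr_ge0//= mulrAC ler_pdivrMr//.
by rewrite ler_wpM2l ?mulr_ge0// ler_nat ltnW.
Qed.

Lemma circle_mean_iter rho N n x : 1 < rho ->
  circle_mean rho N (iter n T x) = iter n T (circle_mean rho N x).
Proof.
move=> r1; have lTn := iter_linear n lT.
rewrite /circle_mean (linZ lTn) (lin_sum lTn); congr (_ *: _).
by apply: eq_bigr => k _; rewrite (linZ lTn) resolvent_iter_comm//; exact: node1.
Qed.

Lemma circle_mean_linear rho N : 1 < rho -> linear (circle_mean rho N).
Proof.
move=> r1 a x y; rewrite /circle_mean scalerA mulrC -scalerA -scalerDr.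
congr (_ *: _); rewrite scaler_sumr -big_split/=; apply: eq_bigr => k _.
have -> := resolvent_linear hspec (node1 N k r1) a x y.
by rewrite scalerDr !scalerA mulrC.
Qed.

(** In the average of [resolvent_pow] over the nodes, the powers [N - j] with 0 < j < N sum to zero
    over the roots of unity; only [j = 0] survives, where every node contributes rho^N. *)
Lemma circle_meanE rho N x : 1 < rho -> (0 < N)%N ->
  circle_mean rho N x - (rho ^+ N)^-1%:C *: iter N T (circle_mean rho N x) = x.
Proof.
move=> r1 N0; have r0 : 0 < rho by rewrite (lt_trans _ r1).
have rN : rho ^+ N != 0 by rewrite expf_neq0// gt_eqF.
have rNC : (rho ^+ N)%:C != 0 by rewrite -(rmorph0 (real_complex R)) (inj_eq (@complexI R)).
have lTN := iter_linear N lT.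
apply: (scalerI rNC); rewrite scalerBr [X in _ - X]scalerA -rmorphM/= divff// scale1r.
rewrite /circle_mean (linZ lTN) (lin_sum lTN) scalerA mulrC -scalerA -scalerBr.
rewrite scaler_sumr -sumrB.
have hk (k : 'I_N) : (rho ^+ N)%:C *: (node rho N k *: Rs (node rho N k) x) -
    iter N T (node rho N k *: Rs (node rho N k) x) =
    \sum_(j < N) node rho N k ^+ (N - j) *: iter j T x.
  rewrite -(resolvent_pow bT hspec (node1 N k r1)); congr (_ *: _ - _).
  rewrite nodeE exprMn -rmorphXn/= exprAC polarX expr1n -[_ *+ N]mulr_natr.
  by rewrite divfK ?pnatr_eq0 -?lt0n// polar_2pi expr1n mulr1.
rewrite (eq_bigr _ (fun k _ => hk k)) exchange_big/=.
case: N N0 {rN rNC lTN hk} => // N _.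
rewrite big_ord_recl/= subn0 [X in _ + X]big1 ?addr0; last first.
  move=> j _; rewrite -scaler_suml.
  under eq_bigr => k _ do rewrite nodeE exprMn.
  rewrite -mulr_sumr sum_root_powers ?mulr0 ?scale0r//.
  by rewrite /bump leq0n add1n subSS subn_gt0 ltn_ord/= ltnS leq_subr.
have hk (k : 'I_N.+1) : node rho N.+1 k ^+ N.+1 = (rho ^+ N.+1)%:C.
  rewrite nodeE exprMn -rmorphXn/= exprAC polarX expr1n -[_ *+ N.+1]mulr_natr.
  by rewrite divfK ?pnatr_eq0// polar_2pi expr1n mulr1.
rewrite -scaler_suml (eq_bigr _ (fun k _ => hk k)) sumr_const card_ord.
rewrite scalerA mulrnAr -mulrnAl -rmorphMn/= -[_^-1 *+ _]mulr_natr.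
by rewrite mulVf ?pnatr_eq0// mul1r.
Qed.

(** A mean of terms bounded by [e] is bounded by [e], whatever their number: this is the uniformity
    in [N] on which the descent to smaller radii rests. *)
Lemma circle_mean_close rho rho' (e : R) N x : (0 < N)%N ->
  (forall t, t \in `[0, 2 * pi] ->
     rnorm (polar rho t *: Rs (polar rho t) x - polar rho' t *: Rs (polar rho' t) x)
       <= e) ->
  rnorm (circle_mean rho N x - circle_mean rho' N x) <= e.
Proof.
move=> N0 h; rewrite /circle_mean -scalerBr -sumrB rnormZ rnorm_real.
rewrite ger0_norm ?invr_ge0// mulrC ler_pdivrMr ?ltr0n//.
rewrite (le_trans (rnorm_sum _ _))//.
apply: le_trans (_ : \sum_(k < N) e <= _).
  by apply: ler_sum => k _; apply: h; exact: node_in.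
by rewrite sumr_const card_ord mulr_natr.
Qed.

Definition power_growth rho : Prop := exists2 K : R, 0 <= K &
  forall n x, rnorm (iter n T x) <= K * rho ^+ n * rnorm x.

(** Growth at [sigma] makes T^n / rho'^n small, so the mean at [rho'] is close to the identity for
    large [n]. The mean at [rho] is then at distance less than 1 from the identity, hence bounded
    below, and this bounds 1 - T^n / rho^n, of which it is the inverse. The case of interest is
    [rho < sigma]. *)
Lemma power_growth_propagate rho rho' sigma :
  1 < rho -> 1 < rho' -> 0 < sigma < rho' -> power_growth sigma ->
  (forall t x, t \in `[0, 2 * pi] ->
     rnorm (polar rho t *: Rs (polar rho t) x - polar rho' t *: Rs (polar rho' t) x)
       <= 4^-1 * rnorm x) ->
  power_growth rho.
Proof.
move=> r1 r'1 /andP[s0 sr'] [K K0 hK] hc.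
have r0 : 0 < rho by rewrite (lt_trans _ r1).
have r'0 : 0 < rho' by rewrite (lt_trans _ r'1).
have [N hN] : exists N, forall n, (N <= n)%N -> (sigma / rho') ^+ n <= (4 * (K + 1))^-1.
  apply: geometric_small; last by rewrite invr_gt0 mulr_gt0// ltr_wpDl.
  by rewrite ltr_pdivrMr// mul1r sr' andbT ltW// divr_gt0.
(* The 2 serves [n >= N]. For [n < N] the ratio [sigma / rho] may exceed 1, and adding 1 makes its
   powers monotone, so that the [N]-th dominates. *)
exists (K * (1 + sigma / rho) ^+ N + 2) => [|n x].
  by rewrite addr_ge0// mulr_ge0// exprn_ge0// addr_ge0// ltW// divr_gt0.
have x0 := rnorm_ge0 x.
have sr0 : 0 <= sigma / rho by rewrite ltW// divr_gt0.
have [nN|Nn] := ltnP n N.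
  rewrite (le_trans (hK n x))// ler_wpM2r// mulrDl.
  rewrite (_ : sigma ^+ n = (sigma / rho) ^+ n * rho ^+ n); last first.
    by rewrite -exprMn divfK ?gt_eqF.
  rewrite mulrA ler_wpDr ?mulr_ge0 ?exprn_ge0 ?(ltW r0) ?(ltW r'0)//.
  rewrite ler_wpM2r ?exprn_ge0 ?(ltW r0) ?(ltW r'0)// ler_wpM2l//.
  rewrite (le_trans (_ : _ <= (1 + sigma / rho) ^+ n))//.
    by rewrite lerXn2r ?nnegrE ?addr_ge0// lerDr.
  by rewrite ler_weXn2l ?lerDl// ltnW.
(* With [n = 0] there are no nodes and the mean is 0, so this case is separate. *)
have [n0|n0] := posnP n.
  rewrite n0 /= expr0 mulr1 ler_peMl// ler_wpDl ?mulr_ge0 ?exprn_ge0 ?addr_ge0//.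
  by rewrite ler1n.
have hT (y : X) : rnorm ((rho' ^+ n)^-1%:C *: iter n T y) <= 4^-1 * rnorm y.
  rewrite rnormZ rnorm_real ger0_norm ?invr_ge0 ?exprn_ge0 ?(ltW r0) ?(ltW r'0)//.
  rewrite mulrC ler_pdivrMr ?exprn_gt0// (le_trans (hK n y))//.
  rewrite [leRHS]mulrAC ler_wpM2r ?rnorm_ge0//.
  rewrite -ler_pdivrMr ?exprn_gt0// -mulrA -expr_div_n.
  rewrite (le_trans (ler_wpM2l K0 (hN n Nn)))//.
  rewrite invfM mulrCA ler_piMr// ler_pdivrMr ?ltr_wpDl// mul1r lerDl ler01//.
(* From d <= (d + |y|) / 4 for the distance d on the left follows d <= |y| / 3. The next bound adds
   the 1/4 of the hypothesis: 1/3 + 1/4 = 7/12. *)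
have hA y : rnorm (circle_mean rho' n y - y) <= 3^-1 * rnorm y.
  have h1 := circle_meanE y r'1 n0; have h2 := hT (circle_mean rho' n y).
  have h3 : rnorm (circle_mean rho' n y) <= rnorm (circle_mean rho' n y - y) + rnorm y.
    by rewrite -{1}(subrK y (circle_mean rho' n y)) rnormD.
  have h4 : circle_mean rho' n y - y = (rho' ^+ n)^-1%:C *: iter n T (circle_mean rho' n y).
    by rewrite -{2}h1 opprB addrC subrK.
  have h5 := rnorm_ge0 y; rewrite h4 in h3 *; lra.
have hB y : rnorm (circle_mean rho n y - y) <= 7 / 12 * rnorm y.
  have h1 := hA y.
  have h2 := circle_mean_close n0 (fun t ht => hc t y ht).
  have h3 : rnorm (circle_mean rho n y - y) <=
      rnorm (circle_mean rho n y - circle_mean rho' n y) + rnorm (circle_mean rho' n y - y).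
    by rewrite -{1}(subrKA (circle_mean rho' n y)) rnormD.
  lra.
(* [circle_meanE] says that the mean is a right inverse of 1 - T^n / rho^n; since it commutes with
   [T], it is also a left inverse, and so it maps [y] to [x]. *)
pose y := x - (rho ^+ n)^-1%:C *: iter n T x.
have hy : circle_mean rho n y = x.
  have lm := circle_mean_linear n r1.
  by rewrite /y (linB lm) (linZ lm) circle_mean_iter// circle_meanE.
have h1 := hB y; rewrite hy in h1.
have h2 : rnorm y <= rnorm (x - y) + rnorm x.
  by rewrite rnorm_distC -{1}(subrK x y) rnormD.
have h3 : rnorm (x - y) <= 2 * rnorm x by lra.
rewrite /y opprB addrC subrK rnormZ rnorm_real in h3.
rewrite ger0_norm ?invr_ge0 ?exprn_ge0 ?(ltW r0) ?(ltW r'0)// in h3.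
rewrite mulrC ler_pdivrMr ?exprn_gt0// in h3.
rewrite (le_trans h3)// mulrAC ler_wpM2r// ler_wpM2r ?exprn_ge0 ?(ltW r0) ?(ltW r'0)//.
by rewrite lerDr mulr_ge0// exprn_ge0// addr_ge0.
Qed.

Lemma resolvent_circle_close (r e : R) : 1 < r -> 0 < e -> exists2 d : R, 0 < d &
  forall rho, 1 < rho -> `|rho - r| <= d -> forall t x, t \in `[0, 2 * pi] ->
  rnorm (polar r t *: Rs (polar r t) x - polar rho t *: Rs (polar rho t) x)
    <= e * rnorm x.
Proof.
move=> r1 e0; have [K K0 hK] := resolvent_circle_bounded hspec r1.
have /bounded_operatorP[_ [L L0 hL]] := bT.
(* The first bound is the smallness required by [resolvent_close]. The second compensates the factor
   2 (K + 1)^2 of that lemma and the norm bound [L] of [T], which enters through z R(z, T) = 1 + T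
   R(z, T). *)
pose d := Num.min (2 * (K + 1))^-1 (e / (2 * (K + 1) ^+ 2 * (L + 1))).
have K1 : 0 < K + 1 by rewrite ltr_wpDl.
have L1 : 0 < L + 1 by rewrite ltr_wpDl.
exists d.
  by rewrite lt_min invr_gt0 mulr_gt0//= divr_gt0// !mulr_gt0// exprn_gt0.
move=> rho rho1 hd t x ht.
have p1 s : 1 < s -> 1 < rnorm (polar s t : R[i]^o).
  by move=> s1; rewrite rnorm_polar// ltW// (lt_trans _ s1).
have r1' := p1 _ r1; have rho1' := p1 _ rho1.
rewrite !resolventE// opprD addrACA subrr add0r -(linB lT).
have hK' y : rnorm (Rs (polar r t) y) <= (K + 1) * rnorm y.
  by rewrite (le_trans (hK t y ht))// ler_wpM2r ?rnorm_ge0// lerDl.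
move: hd; rewrite le_min => /andP[d1 d2].
have [||_ h] := resolvent_close hspec r1' rho1' hK' _ _ x.
- exact: ltW.
- rewrite rnorm_polarB (le_trans (ler_wpM2l (ltW K1) d1))//.
  by rewrite invfM mulrCA divff ?gt_eqF// mulr1.
rewrite (le_trans (hL _))// (le_trans (ler_wpM2l L0 h))// rnorm_polarB.
rewrite mulrA ler_wpM2r ?rnorm_ge0//.
move: d2; rewrite ler_pdivlMr ?mulr_gt0 ?exprn_gt0//; apply: le_trans.
have : 0 <= K ^+ 2 * `|rho - r| by rewrite mulr_ge0// sqr_ge0.
have := normr_ge0 (rho - r); nra.
Qed.

Lemma power_growth_gt1 rho : 1 < rho -> power_growth rho.
Proof.
have pb_mono s s' : 1 < s -> s <= s' -> power_growth s -> power_growth s'.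
  move=> s1 ss' [K K0 hK]; exists K => // n x; rewrite (le_trans (hK n x))//.
  rewrite ler_wpM2r ?rnorm_ge0// ler_wpM2l//.
  by rewrite lerXn2r ?nnegrE ?(le_trans _ ss')// ltW// (lt_trans _ s1).
have /bounded_operatorP[_ [L L0 hL]] := bT.
pose S := [set s | 1 < s /\ power_growth s].
have SL : S (L + 2).
  split; first by lra.
  exists 1 => // n x; rewrite mul1r; elim: n => [|n ih] /=.
    by rewrite expr0 mul1r.
  rewrite (le_trans (hL _))// (le_trans (ler_wpM2l L0 ih))//.
  rewrite mulrA ler_wpM2r ?rnorm_ge0// exprS ler_wpM2r ?exprn_ge0//; lra.
have infS : has_inf S.
  by split; [exists (L + 2)|exists 1 => s [/ltW]].
move=> rho1; apply: contrapT => nrho.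
have rS : rho <= inf S.
  apply: lb_le_inf; first by exists (L + 2).
  move=> s [s1 hs]; rewrite leNgt; apply/negP => srho.
  by apply: nrho; apply: pb_mono hs => //; exact: ltW.
set r := inf S in rS; have r1 : 1 < r by exact: lt_le_trans rS.
(* The circles of radii [r - e] and [r + e] are each compared with the one of radius [r]; two errors
   of 1/8 give the 1/4 needed for propagation. *)
have e8 : (0 : R) < 8^-1 by rewrite invr_gt0.
have [d d0 hd] := resolvent_circle_close r1 e8.
pose e := Num.min d ((r - 1) / 2).
have e0 : 0 < e by rewrite lt_min d0 divr_gt0// subr_gt0.
have ed : e <= d by rewrite ge_min lexx.
have er : e <= (r - 1) / 2 by rewrite ge_min lexx orbT.
have [s [s1 hs] sr] : exists2 s, S s & s < r + e.
  by apply: inf_adherent.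
have rs : r <= s by apply: ge_inf => //; exact: (proj2 infS).
(* Growth at some [s < r + e] propagates to [r - e], which is still above 1: a member of [S] below
   its infimum. *)
suff : r <= r - e by rewrite leNgt ltrBlDr ltrDl e0.
apply: ge_inf; first exact: (proj2 infS).
split; first by lra.
apply: (@power_growth_propagate _ (r + e) s) => //; [lra|lra|apply/andP; split; lra|].
move=> t x ht.
have h1 := hd (r - e) _ _ t x ht; have h2 := hd (r + e) _ _ t x ht.
set a := _ *: _; set b := _ *: _.
set c := polar r t *: Rs (polar r t) x in h1 h2.
have -> : a - b = (c - b) - (c - a) by rewrite opprB [RHS]addrC subrKA.
rewrite (le_trans (rnormB _ _))//.
have -> : 4^-1 * rnorm x = 8^-1 * rnorm x + 8^-1 * rnorm x by lra.
apply: lerD.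
  by apply: h2; [lra|rewrite addrC addKr ger0_norm// ltW].
by apply: h1; [lra|rewrite addrC addKr normrN ger0_norm// ltW].
Qed.

End PowerGrowth.

(** * Riesz representation and adjoints *)

Section Conj.
Variable R : realType.
Implicit Type z : R[i].

(** The abstract conjugation is known only through z conj(z) = |z|^2 and through fixing the reals;
    the first at z = i forces conj(i) = -i. *)
Lemma conj_complex z : Num.conj z = (complex.Re z) +i* (- complex.Im z).
Proof.
have conj_real (a : R) : Num.conj a%:C = a%:C.
  by apply/CrealP/complex_realP; exists a.
have conj_i : Num.conj ('i%C : R[i]) = - 'i%C.
  have i0 : ('i%C : R[i]) != 0 by rewrite eq_complex/= oner_eq0 andbF.
  apply: (mulfI i0); rewrite -normCK mulrN -expr2 sqr_i opprK.
  by rewrite normc_def/= expr0n/= add0r expr1n sqrtr1 expr1n.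
rewrite {1}(complexE z) rmorphD rmorphM/= conj_i !conj_real.
by rewrite mulNr -mulrN [RHS]complexE/= rmorphN.
Qed.

Lemma Re_conj z : complex.Re (Num.conj z) = complex.Re z.
Proof. by rewrite conj_complex. Qed.

Lemma mulc_conj z : Num.conj z * z = (rnorm (z : R[i]^o) ^+ 2)%:C.
Proof. by rewrite mulrC -normCK rmorphXn/= -(rnormE (z : R[i]^o)). Qed.

Lemma rnorm_conj z : rnorm (Num.conj z : R[i]^o) = rnorm (z : R[i]^o).
Proof.
apply/eqP; rewrite -(@eqrXn2 _ 2)// ?rnorm_ge0// !rnormc_sqr.
by rewrite conj_complex/= sqrrN.
Qed.

Lemma ReD (a b : R[i]) : complex.Re (a + b) = complex.Re a + complex.Re b.
Proof. by case: a b => [? ?] []. Qed.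

Lemma ReN (a : R[i]) : complex.Re (- a) = - complex.Re a.
Proof. by case: a. Qed.

Lemma ReM_real (a : R) (b : R[i]) : complex.Re (a%:C * b) = a * complex.Re b.
Proof. by case: b => b c; rewrite /= mul0r subr0. Qed.

End Conj.

Section InnerProduct.
Variables (R : realType) (H : completeNormedModType R[i]).
Variables (dot : {dot H for Num.conj}).
Hypothesis hdot : hilbert_dot dot.
Implicit Types x y z : H.

Lemma dotC x y : dot x y = Num.conj (dot y x).
Proof. by rewrite [LHS]hermC expr0 mul1r. Qed.

Lemma dotDl x y z : dot (x + y) z = dot x z + dot y z.
Proof. exact: linearDl. Qed.

Lemma dotDr x y z : dot z (x + y) = dot z x + dot z y.
Proof. exact: linearDr. Qed.

Lemma dotBl x y z : dot (x - y) z = dot x z - dot y z.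
Proof. exact: linearBl. Qed.

Lemma dotBr x y z : dot z (x - y) = dot z x - dot z y.
Proof. exact: linearBr. Qed.

Lemma dotZl a x y : dot (a *: x) y = a * dot x y.
Proof. exact: linearZl_LR. Qed.

Lemma dotZr a x y : dot x (a *: y) = Num.conj a * dot x y.
Proof. exact: linearZr_LR. Qed.

Lemma dot_suml (I : Type) (s : seq I) (F : I -> H) y :
  dot (\sum_(i <- s) F i) y = \sum_(i <- s) dot (F i) y.
Proof. exact: (big_morph _ (fun u v => dotDl u v y) (linear0l dot y)). Qed.

Lemma dot_sumr (I : Type) (s : seq I) (F : I -> H) y :
  dot y (\sum_(i <- s) F i) = \sum_(i <- s) dot y (F i).
Proof. exact: (big_morph _ (fun u v => dotDr u v y) (linear0r dot y)). Qed.

Lemma Re_dotC x y : complex.Re (dot x y) = complex.Re (dot y x).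
Proof. by rewrite dotC Re_conj. Qed.

Lemma dotxx x : dot x x = (rnorm x ^+ 2)%:C.
Proof. by rewrite -hdot rnormE rmorphXn. Qed.

Lemma rnorm_sqrD x y :
  rnorm (x + y) ^+ 2 = rnorm x ^+ 2 + rnorm y ^+ 2 + 2 * complex.Re (dot x y).
Proof.
have := dotxx (x + y); rewrite dotDl !dotDr !dotxx => /(congr1 (@complex.Re R)).
rewrite !ReD/= (Re_dotC y x) => <-; ring.
Qed.

Lemma rnorm_sqrB x y :
  rnorm (x - y) ^+ 2 = rnorm x ^+ 2 + rnorm y ^+ 2 - 2 * complex.Re (dot x y).
Proof.
rewrite rnorm_sqrD rnormN -scaleN1r dotZr rmorphN1 mulN1r ReN; ring.
Qed.

Lemma Re_dot_le x y : complex.Re (dot x y) <= rnorm x * rnorm y.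
Proof.
have x0 := rnorm_ge0 x; have y0 := rnorm_ge0 y.
have [xz|xn] := eqVneq (rnorm x) 0.
  by rewrite (rnorm_eq0 xz) linear0l rnorm0 mul0r.
have [yz|yn] := eqVneq (rnorm y) 0.
  by rewrite (rnorm_eq0 yz) linear0r rnorm0 mulr0.
have xp : 0 < rnorm x by rewrite lt_def xn.
have yp : 0 < rnorm y by rewrite lt_def yn.
have := sqr_ge0 (rnorm ((rnorm y)%:C *: x - (rnorm x)%:C *: y)).
rewrite rnorm_sqrB !rnormZ !rnorm_real !ger0_norm// dotZl dotZr.
rewrite conj_complex/= oppr0 !ReM_real.
have p : 0 < 2 * (rnorm x * rnorm y) by rewrite !mulr_gt0.
move=> h; rewrite -(ler_pM2l p); nra.
Qed.

(** Multiplying [x] by the conjugate of [dot x y] makes the product real and nonnegative, which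
    reduces the claim to [Re_dot_le]. *)
Lemma cauchy_schwarz x y : rnorm (dot x y : R[i]^o) <= rnorm x * rnorm y.
Proof.
set c := dot x y; have c0 := rnorm_ge0 (c : R[i]^o).
have [cz|cn] := eqVneq (rnorm (c : R[i]^o)) 0.
  by rewrite cz mulr_ge0 ?rnorm_ge0.
have cp : 0 < rnorm (c : R[i]^o) by rewrite lt_def cn.
have := Re_dot_le (Num.conj c *: x) y.
rewrite dotZl -/c mulc_conj/= rnormZ rnorm_conj expr2 -mulrA.
by rewrite ler_pM2l.
Qed.

Lemma dot_bounded_functional y : bounded_functional (fun x => dot x y : R[i]^o).
Proof.
apply/bounded_operatorP; split; first by move=> a u v; rewrite dotDl dotZl.
exists (rnorm y); first exact: rnorm_ge0.
by move=> x; rewrite mulrC; exact: cauchy_schwarz.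
Qed.

Lemma opnorm_dot_le y : opnorm (fun x => dot x y : R[i]^o) <= rnorm y.
Proof.
apply: opnorm_le; first exact: rnorm_ge0.
by move=> x; rewrite mulrC; exact: cauchy_schwarz.
Qed.

Lemma dot_injr y z : (forall x, dot x y = dot x z) -> y = z.
Proof.
move=> h; apply/eqP; rewrite -subr_eq0; apply/eqP; apply: rnorm_eq0.
have := dotxx (y - z); rewrite dotBr h subrr => /(congr1 (@complex.Re R))/= /esym/eqP.
by rewrite sqrf_eq0 => /eqP.
Qed.

Lemma cauchy_converges (u : nat -> H) :
  (forall e : R, 0 < e -> exists N, forall n k, (N <= n)%N -> (N <= k)%N ->
     rnorm (u n - u k) <= e) ->
  exists y, forall e : R, 0 < e -> exists N, forall n, (N <= n)%N ->
     rnorm (u n - y) <= e.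
Proof.
move=> h.
have /cvg_ex[y hy] : cvg (u @ \oo).
  apply/cauchy_cvgP; apply/cauchy_exP => _ /gt0_complexP[e e0 ->].
  have [N hN] := h _ (divr_gt0 e0 (ltr0n R 2)).
  exists (u N); exists N => // n /= Nn; rewrite -ball_normE/= rnormE ltcR.
  by rewrite (le_lt_trans (hN _ _ _ _))// ltr_pdivrMr// ltr_pMr// ltr1n.
exists y => e e0; have eC : 0 < e%:C by rewrite ltcR.
have /cvgrPdist_le/(_ _ eC)[N _ hN] := hy.
by exists N => n Nn; have := hN n Nn; rewrite /= rnormE lecR rnorm_distC.
Qed.

(* The representing vector minimises [|x|^2 - 2 Re f(x)]; a minimising sequence
   is Cauchy by the parallelogram law. *)
Theorem riesz_representation (f : H -> R[i]^o) : bounded_functional f ->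
  exists y, forall x, f x = dot x y.
Proof.
move=> /bounded_operatorP[lf [K K0 hK]].
pose J x : R := rnorm x ^+ 2 - 2 * complex.Re (f x).
have hJ x : - K ^+ 2 <= J x.
  have h1 := hK x; have h2 := Re_le_rnorm (f x).
  have := sqr_ge0 (rnorm x - K); rewrite /J; nra.
pose m := inf (range J).
have iJ : has_inf (range J).
  by split; [exists (J 0), 0|exists (- K ^+ 2) => _ [x _ <-]].
have mJ x : m <= J x by apply: ge_inf; [exact: (proj2 iJ)|exists x].
have /choice[u hu] (n : nat) : exists x, J x <= m + n.+1%:R^-1.
  have n0 : (0 : R) < n.+1%:R^-1 by rewrite invr_gt0 ltr0n.
  by have [_ [x _ <-] /ltW hx] := inf_adherent n0 iJ; exists x.
have par x y : rnorm (x - y) ^+ 2 = 2 * J x + 2 * J y - 4 * J ((2^-1 : R)%:C *: (x + y)).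
  rewrite /J rnormZ rnorm_real ger0_norm ?invr_ge0// exprMn rnorm_sqrB rnorm_sqrD.
  by rewrite (linZ lf) (linD lf) ReM_real ReD; field.
have small (e : R) : 0 < e -> exists N, forall n, (N <= n)%N -> n.+1%:R^-1 <= e.
  move=> e0; have /cvgrPdist_le/(_ e e0)[N _ hN] := @cvg_harmonic R.
  by exists N => n Nn; have := hN n Nn; rewrite /= sub0r normrN ger0_norm.
have [y hy] : exists y, forall e : R, 0 < e -> exists N, forall n, (N <= n)%N ->
     rnorm (u n - y) <= e.
  apply: cauchy_converges => e e0.
  have [N hN] := small (e ^+ 2 / 4) (divr_gt0 (exprn_gt0 2 e0) (ltr0n R 4)).
  exists N => n k Nn Nk; rewrite -(@ler_pXn2r _ 2)// ?nnegrE ?rnorm_ge0 ?(ltW e0)//.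
  rewrite par; have := mJ ((2^-1 : R)%:C *: (u n + u k)).
  have := hu n; have := hu k; have := hN n Nn; have := hN k Nk.
  move: (J (u n)) (J (u k)) (n.+1%:R^-1) (k.+1%:R^-1) (e ^+ 2) => *; lra.
exists y => z.
pose g x := dot x y - f x.
(* This is [J (y + x) >= J y] written out. It is obtained along [u n], from J(u n + x) >= m >= J(u
   n) - 1/(n+1); the [e] below makes the total error e + 2 |x| e equal to half of [- v]. *)
have hg x : 0 <= rnorm x ^+ 2 + 2 * complex.Re (g x).
  rewrite leNgt; apply/negP => hlt.
  set v := _ + _ in hlt; pose e := - v / (2 * (1 + 2 * rnorm x)).
  have x0 := rnorm_ge0 x.
  have d0 : 0 < 2 * (1 + 2 * rnorm x) by rewrite mulr_gt0// ltr_wpDr ?mulr_ge0.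
  have e0 : 0 < e by rewrite divr_gt0 ?oppr_gt0.
  have [N1 h1] := small e e0; have [N2 h2] := hy e e0.
  pose n := maxn N1 N2.
  have {}h1 := h1 n (leq_maxl _ _); have {}h2 := h2 n (leq_maxr _ _).
  have h3 := hu n; have h4 := mJ (u n + x).
  have h5 : J (u n + x) = J (u n) + rnorm x ^+ 2 + 2 * complex.Re (dot x (u n)) - 2 * complex.Re (f x).
    rewrite /J rnorm_sqrD (linD lf) ReD Re_dotC; ring.
  have h6 : complex.Re (dot x (u n)) <= complex.Re (dot x y) + rnorm x * e.
    rewrite -{1}(subrK y (u n)) dotDr ReD addrC lerD2l.
    by rewrite (le_trans (Re_dot_le _ _))// ler_wpM2l.
  have h7 : v = rnorm x ^+ 2 + 2 * (complex.Re (dot x y) - complex.Re (f x)).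
    by rewrite /v /g ReD ReN.
  have h8 : e * (2 * (1 + 2 * rnorm x)) = - v by rewrite /e divfK ?gt_eqF.
  have h9 : 2 * e + 4 * (rnorm x * e) = - v by rewrite -h8; ring.
  move: h1 h3 h4; rewrite h5; move: h6 h7 h9 hlt.
  move: (n.+1%:R^-1) (J (u n)) (rnorm x * e) (complex.Re _) (complex.Re _) (complex.Re _) (rnorm x ^+ 2) => *; lra.
(* The test vector - e conj(c) z turns [hg] into |c|^2 (e^2 |z|^2 - 2 e) >= 0. With this [e], e^2
   |z|^2 < e, so [c] vanishes. *)
pose c := g z; pose e := (1 + rnorm z ^+ 2)^-1.
have z2 := sqr_ge0 (rnorm z).
have e0 : 0 < e by rewrite invr_gt0 ltr_wpDr.
have := hg (- (e%:C * Num.conj c) *: z).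
have -> : g (- (e%:C * Num.conj c) *: z) = (- (e * rnorm (c : R[i]^o) ^+ 2))%:C.
  rewrite /g dotZl (linZ lf) -[_ *: f z]/(_ * f z) -mulrBr -/(g z) -/c.
  by rewrite mulNr -mulrA mulc_conj -rmorphM -rmorphN.
rewrite rnormZ rnormN rnormcM rnorm_real rnorm_conj (gtr0_norm e0)/=.
set k := rnorm _ => hk.
have h9 : e * (1 + rnorm z ^+ 2) = 1 by rewrite mulVf// gt_eqF// ltr_wpDr.
have : k ^+ 2 * e * (e * (1 + rnorm z ^+ 2)) - k ^+ 2 * e ^+ 2 - 2 * k ^+ 2 * e >= 0.
  apply: (le_trans hk); rewrite le_eqVlt; apply/orP; left; apply/eqP; ring.
rewrite h9 mulr1 => hle.
have k2 := sqr_ge0 k.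
have : k ^+ 2 * e <= 0.
  have : 0 <= k ^+ 2 * e ^+ 2 by rewrite mulr_ge0// sqr_ge0.
  lra.
rewrite pmulr_lle0// => k20.
have : k ^+ 2 == 0 by rewrite eq_le k20 k2.
rewrite sqrf_eq0 => /eqP/rnorm_eq0 c0.
by apply/esym/eqP; rewrite -subr_eq0; apply/eqP.
Qed.

(** Take x = B y: then |B y|^2 = <A (B y), y> <= K |B y| |y|. *)
Lemma adjoint_bound (A B : H -> H) (K : R) : 0 <= K ->
  (forall x, rnorm (A x) <= K * rnorm x) ->
  (forall x y, dot (A x) y = dot x (B y)) ->
  forall y, rnorm (B y) <= K * rnorm y.
Proof.
move=> K0 hA hB y; have [b0|bn] := eqVneq (rnorm (B y)) 0.
  by rewrite b0 mulr_ge0 ?rnorm_ge0.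
have bp : 0 < rnorm (B y) by rewrite lt_def bn rnorm_ge0.
rewrite -(ler_pM2l bp) -expr2.
have := dotxx (B y); rewrite -hB => /(congr1 (@complex.Re R))/= <-.
rewrite (le_trans (Re_dot_le _ _))// mulrCA mulrA.
by rewrite ler_wpM2r ?rnorm_ge0.
Qed.

Lemma adjointP (A : H -> H) : bounded_operator A ->
  bounded_operator (adjoint dot A) /\
  forall x y, dot (A x) y = dot x (adjoint dot A y).
Proof.
move=> bA; have /bounded_operatorP[lA [K K0 hK]] := bA.
have /choice[B hB] y : exists b, forall x, dot (A x) y = dot x b.
  apply: (@riesz_representation (fun x => dot (A x) y)).
  apply/bounded_operatorP; split.
    by move=> a u v; rewrite (linD lA) (linZ lA) dotDl dotZl.
  exists (K * rnorm y); first by rewrite mulr_ge0 ?rnorm_ge0.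
  move=> x; rewrite (le_trans (cauchy_schwarz _ _))// mulrAC.
  by rewrite ler_wpM2r ?rnorm_ge0.
have bB : bounded_operator B.
  apply/bounded_operatorP; split.
    move=> a u v; apply: dot_injr => x.
    by rewrite dotDr dotZr -!hB dotDr dotZr.
  by exists K => //; apply: adjoint_bound hK _ => // x y; exact: hB.
exact: (@xgetPex _ (fun=> 0)
  [set B | bounded_operator B /\ forall x y, dot (A x) y = dot x (B y)]
  (ex_intro _ B (conj bB (fun x y => hB y x)))).
Qed.

End InnerProduct.

(** * Integrals of trigonometric polynomials *)

Section CircleIntegral.
Variable R : realType.
Implicit Types (g h : R -> R).
Let D : set R := [set` `[0, 2 * pi] ].
Let mu := @lebesgue_measure R.

(** Real-valued, so that estimates are ordinary real arithmetic; on continuous functions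
    [circle_integralE] recovers the extended integral. *)
Definition circle_integral g : R := fine (\int[mu]_(t in D) (g t)%:E)%E.

Let mD : measurable D. Proof. exact: measurable_itv. Qed.

Let circle_integrable g : continuous g -> mu.-integrable D (EFin \o g).
Proof.
move=> cg; apply: continuous_compact_integrable; first exact: segment_compact.
exact: continuous_subspaceT.
Qed.

Lemma circle_integralE g : continuous g ->
  (\int[mu]_(t in D) (g t)%:E)%E = (circle_integral g)%:E.
Proof.
by move=> cg; rewrite fineK//; apply: integrable_fin_num => //; exact: circle_integrable.
Qed.

Lemma circle_integralD g h : continuous g -> continuous h ->
  circle_integral (fun t => g t + h t) = circle_integral g + circle_integral h.
Proof. by move=> cg ch; apply: RintegralD => //; exact: circle_integrable. Qed.

Lemma circle_integralZ c g : continuous g ->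
  circle_integral (fun t => c * g t) = c * circle_integral g.
Proof. by move=> cg; apply: RintegralZl => //; exact: circle_integrable. Qed.

Lemma circle_integral_cst c : circle_integral (fun=> c) = 2 * pi * c.
Proof.
have muD : mu D = (2 * pi)%:E.
  rewrite [LHS](lebesgue_measure_itv `[0, 2 * pi])/= lte_fin mulr_gt0 ?pi_gt0//.
  by rewrite -EFinB subr0.
rewrite /circle_integral -/(Rintegral mu D (fun=> c)) Rintegral_cst//.
by transitivity (c * fine (2 * pi)%:E); [congr (_ * fine _); exact: muD|rewrite mulrC].
Qed.

Lemma circle_integral_le g h : continuous g -> continuous h ->
  (forall t, t \in `[0, 2 * pi] -> g t <= h t) ->
  circle_integral g <= circle_integral h.
Proof.
move=> cg ch gh; apply: le_Rintegral => //.
- exact: circle_integrable.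
- exact: circle_integrable.
Qed.

Lemma continuous_sqr g : continuous g -> continuous (fun t => g t ^+ 2).
Proof. by move=> cg t; apply: cvgM; exact: cg. Qed.

Lemma continuous_sum (I : Type) (s : seq I) (F : I -> R -> R) :
  (forall i, continuous (F i)) -> continuous (fun t => \sum_(i <- s) F i t).
Proof.
move=> cF; elim: s => [|i s ih].
  by under eq_fun do rewrite big_nil; move=> t; exact: cvg_cst.
under eq_fun do rewrite big_cons.
by move=> t; apply: cvgD; [exact: cF|exact: ih].
Qed.

Lemma circle_integral_sum (I : Type) (s : seq I) (F : I -> R -> R) :
  (forall i, continuous (F i)) ->
  circle_integral (fun t => \sum_(i <- s) F i t) = \sum_(i <- s) circle_integral (F i).
Proof.
move=> cF; elim: s => [|i s ih].
  rewrite big_nil -[RHS](mulr0 (2 * pi)) -circle_integral_cst; congr circle_integral.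
  by apply/funext => t; rewrite big_nil.
rewrite big_cons -ih -circle_integralD//; last exact: continuous_sum.
by congr circle_integral; apply/funext => t; rewrite big_cons.
Qed.

Lemma polar_period (p : int) : polar 1 (p%:~R * (2 * pi)) = 1 :> R[i].
Proof.
have h n : polar 1 (n%:R * (2 * pi)) = 1 :> R[i].
  rewrite [n%:R * _]mulr_natl.
  by have := polarX 1 (2 * pi : R) n; rewrite polar_2pi !expr1n => <-.
case: p => n; first exact: h.
by rewrite NegzE mulrNz mulNr -[X in polar X]invr1 -polar_inv ?oner_eq0// h invr1.
Qed.

Lemma continuous_trig (p : int) (a : R[i]) :
  continuous (fun t : R => complex.Re (polar 1 (p%:~R * t) * a)).
Proof.
case: a => a b; rewrite (_ : (fun t : R => _) = fun t : R =>
  cos (p%:~R * t) * a - sin (p%:~R * t) * b); last first.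
  by apply/funext => t /=; rewrite !mul1r.
have cp : continuous (fun t : R => p%:~R * t).
  by move=> t; apply: cvgM; [exact: cvg_cst|exact: cvg_id].
move=> t; apply: cvgB; apply: cvgM; try exact: cvg_cst.
  apply: (@continuous_comp _ _ _ (fun t : R => p%:~R * t) cos); first exact: cp.
  exact: continuous_cos.
apply: (@continuous_comp _ _ _ (fun t : R => p%:~R * t) sin); first exact: cp.
exact: continuous_sin.
Qed.

Lemma circle_integral_trig (p : int) (a : R[i]) :
  circle_integral (fun t => complex.Re (polar 1 (p%:~R * t) * a)) =
  if p == 0 then 2 * pi * complex.Re a else 0.
Proof.
have [->|p0] := eqVneq p 0.
  rewrite -circle_integral_cst; congr circle_integral; apply/funext => t.
  by rewrite mul0r polar0 mul1r.
have cf := @continuous_trig p a; set f := fun t : R => _.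
have pi0 := pi_gt0 R.
case: a @f cf => a b f cf.
have pR : p%:~R != 0 :> R by rewrite intr_eq0.
(* An explicit primitive, periodic because [p] is an integer, so its increment over the interval is
   zero. *)
pose F (t : R) := (p%:~R)^-1 * (sin (p%:~R * t) * a + cos (p%:~R * t) * b).
have dF (t : R) : is_derive t (1 : R) F (f t).
  have dp : is_derive t (1 : R) (fun t : R => p%:~R * t) (p%:~R : R).
    by apply: is_derive_eq; rewrite [LHS]mulr1.
  have ds := @is_derive1_comp _ sin _ t _ _ (is_derive_sin (p%:~R * t)) dp.
  have dc := @is_derive1_comp _ cos _ t _ _ (is_derive_cos (p%:~R * t)) dp.
  rewrite /F; apply: is_derive_eq.
  rewrite /f/= !scaler0 !add0r !mul1r /GRing.scale/=; by field.
have F0 : F (2 * pi) = F 0.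
  rewrite /F mulr0 sin0 cos0.
  have := congr1 (@complex.Re R) (polar_period p).
  have := congr1 (@complex.Im R) (polar_period p).
  by rewrite /= !mul1r => -> ->; rewrite mul1r.
have cF t : F x @[x --> t] --> F t.
  by apply/differentiable_continuous/derivable1_diffP; exact: ex_derive.
rewrite /circle_integral.
have -> : (\int[mu]_(t in D) (f t)%:E = (F (2 * pi))%:E - (F 0)%:E)%E.
  apply: continuous_FTC2.
  - by rewrite mulr_gt0.
  - exact: continuous_subspaceT.
  - split.
    + by move=> t _; exact: ex_derive.
    + exact: cvg_at_right_filter.
    + exact: cvg_at_left_filter.
  - by move=> t _; rewrite derive1E; exact: derive_val.
by rewrite F0 subee.
Qed.

End CircleIntegral.

(** * Neumann series with exact remainder *)

Section Neumann.
Variables (R : realType) (X : lmodType R[i]) (T : X -> X).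
Hypothesis lT : linear T.

Lemma neumann_expansion (w : R[i]) x V N : V = w *: (x + T V) ->
  V = \sum_(n < N) w ^+ n.+1 *: iter n T x + w ^+ N *: iter N T V.
Proof.
move=> hV; elim: N => [|N ih]; first by rewrite big_ord0 expr0 scale1r add0r.
rewrite {1}ih big_ord_recr/= -addrA; congr (_ + _).
have lN := iter_linear N lT.
by rewrite {1}hV (linZ lN) (linD lN) scalerA -exprSr scalerDr -iterSr.
Qed.

(** For w = 1/z, [V] is R(z, T)x and [U] is R(z, T)^2 x. The coefficients of the squared series grow
    linearly, whence the term [(N%:R * w) *: V] in the remainder. *)
Lemma neumann_expansion2 (w : R[i]) x V U N :
  V = w *: (x + T V) -> U = w *: (V + T U) ->
  U = \sum_(n < N) (n.+1%:R * w ^+ n.+2) *: iter n T x +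
      w ^+ N *: iter N T (U + (N%:R * w) *: V).
Proof.
move=> hV hU; elim: N => [|N ih].
  by rewrite big_ord0 expr0 scale1r add0r mul0r scale0r addr0.
rewrite {1}ih big_ord_recr/= -addrA; congr (_ + _).
have lN := iter_linear N lT.
have -> : U + (N%:R * w) *: V = (N.+1%:R * w ^+ 2) *: x +
    w *: (T (U + (N.+1%:R * w) *: V)).
  rewrite (linD lT) (linZ lT).
  have -> : U + (N%:R * w) *: V = (N.+1%:R * w) *: V + w *: T U.
    rewrite {1}hU scalerDr addrAC -scalerDl -natr1; congr (_ *: _ + _); ring.
  rewrite {1}hV !scalerDr !scalerA -addrA [w *: _ + _]addrC expr2 mulrA.
  by rewrite [w * (_ * w)]mulrC.
rewrite [in LHS](linD lN) ![in LHS](linZ lN) scalerDr !scalerA -exprSr.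
by rewrite -iterSr iterS mulrCA -exprD addn2.
Qed.

End Neumann.

Lemma expr_int_mulrn (R : realType) (s : int) (t : R) n :
  (- (s%:~R * t)) *+ n = ((- s) * n%:Z)%:~R * t.
Proof. by rewrite -mulr_natr intrM mulrNz; ring. Qed.

Lemma Re_sum (R : realType) (I : Type) (s : seq I) (F : I -> R[i]) :
  complex.Re (\sum_(i <- s) F i) = \sum_(i <- s) complex.Re (F i).
Proof. exact: (big_morph (@complex.Re R) (@ReD R) erefl). Qed.

(** * Parseval identity and the square-mean estimate *)

Section Parseval.
Variables (R : realType) (H : completeNormedModType R[i]).
Variables (dot : {dot H for Num.conj}).
Hypothesis hdot : hilbert_dot dot.

Let trig_poly N (c : nat -> R) (k : nat -> int) (y : nat -> H) t : H :=
  \sum_(n < N) polar (c n) ((k n)%:~R * t) *: y n.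

Let trig_polyE N (c : nat -> R) (k : nat -> int) (y : nat -> H) :
  (fun t => rnorm (trig_poly N c k y t) ^+ 2) = fun t =>
  \sum_(m < N) \sum_(n < N)
    complex.Re (polar 1 ((k m - k n)%:~R * t) * ((c m * c n)%:C * dot (y m) (y n))).
Proof.
apply/funext => t; have := dotxx hdot (trig_poly N c k y t).
move=> /(congr1 (@complex.Re R))/= <-.
rewrite {1}/trig_poly dot_suml Re_sum; apply: eq_bigr => m _.
rewrite /trig_poly dot_sumr Re_sum; apply: eq_bigr => n _.
rewrite dotZl dotZr mulrA; congr complex.Re.
rewrite conj_complex/= mulrA [polar 1 _ * _]mulrC polar_real mulr1; congr (_ * _).
have -> : c n * cos ((k n)%:~R * t) +i* - (c n * sin ((k n)%:~R * t)) =
    polar (c n) (- ((k n)%:~R * t)) by rewrite /polar cosN sinN mulrN.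
by rewrite polarM rmorphB/= mulrBl.
Qed.

Lemma parseval_continuous N (c : nat -> R) (k : nat -> int) (y : nat -> H) :
  continuous (fun t : R => rnorm (\sum_(n < N) polar (c n) ((k n)%:~R * t) *: y n) ^+ 2).
Proof.
rewrite (trig_polyE N c k y); apply: continuous_sum => m.
by apply: continuous_sum => n; exact: continuous_trig.
Qed.

(** In the double sum of inner products the term (m, n) has frequency [k m - k n], so only the
    diagonal has a nonzero integral. The radii [c n] carry the powers of 1/r, and general [k] allows
    both orientations of the circle. *)
Lemma parseval N (c : nat -> R) (k : nat -> int) (y : nat -> H) : injective k ->
  circle_integral
    (fun t => rnorm (\sum_(n < N) polar (c n) ((k n)%:~R * t) *: y n) ^+ 2) =
  2 * pi * \sum_(n < N) c n ^+ 2 * rnorm (y n) ^+ 2.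
Proof.
move=> ik; rewrite (trig_polyE N c k y) circle_integral_sum; last first.
  by move=> m; apply: continuous_sum => n; exact: continuous_trig.
rewrite mulr_sumr; apply: eq_bigr => m _.
rewrite circle_integral_sum => [|n]; last exact: continuous_trig.
under eq_bigr => n _ do rewrite circle_integral_trig subr_eq0 (inj_eq ik).
rewrite (bigD1 m)//= eqxx big1 ?addr0 => [|n nm]; last first.
  by rewrite eq_sym (_ : (n == m :> nat) = false)//; apply/negbTE.
by rewrite ReM_real (dotxx hdot)/= expr2.
Qed.

(** Only the resolvent equation for [V] is used, so that [s = 1] covers the resolvent of [T] and
    [s = -1] its adjoint, which is the resolvent of the adjoint of [T] at the conjugate point. *)
Lemma circle_square_bound (T : H -> H) (M K r : R) (s : int) (x : H) (V : R -> H) :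
  linear T -> 0 <= M -> (forall n x, rnorm (iter n T x) <= M * rnorm x) ->
  s != 0 -> 1 < r -> 0 <= K ->
  (forall t, polar r (s%:~R * t) *: V t = x + T (V t)) ->
  (forall t, t \in `[0, 2 * pi] -> rnorm (V t) <= K) ->
  continuous (fun t : R => rnorm (V t)) ->
  (r ^+ 2 - 1) * circle_integral (fun t => rnorm (V t) ^+ 2) <=
  2 * pi * M ^+ 2 * rnorm x ^+ 2.
Proof.
move=> lT M0 hM s0 r1 K0 hV hK cV.
have r0 : 0 < r by rewrite (lt_trans _ r1).
have q0 : 0 < r^-1 by rewrite invr_gt0.
have q1 : r^-1 < 1 by rewrite invf_lt1.
have r21 : 0 < r ^+ 2 - 1 by rewrite subr_gt0 exprn_egt1.
have cV2 : continuous (fun t : R => rnorm (V t) ^+ 2).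
  exact: continuous_sqr.
have pi0 := pi_gt0 R.
pose S N t := \sum_(n < N) polar (r^-1 ^+ n.+1) (((- s) * n.+1%:Z)%:~R * t) *: iter n T x.
pose E N t := polar (r^-1 ^+ N) (((- s) * N%:Z)%:~R * t) *: iter N T (V t).
have VSE N t : V t = S N t + E N t.
  have p0 : polar r (s%:~R * t) != 0.
    apply/eqP => p0; have := @rnorm_polar R r (s%:~R * t) (ltW r0).
    by rewrite p0 rnorm0 => r00; rewrite -r00 ltxx in r0.
  have hw : V t = polar r^-1 (- (s%:~R * t)) *: (x + T (V t)).
    by rewrite -polar_inv ?gt_eqF// -hV scalerA mulVf// scale1r.
  rewrite {1}(neumann_expansion lT N hw) /S /E; congr (_ + _).
    by apply: eq_bigr => n _; rewrite polarX expr_int_mulrn.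
  by rewrite polarX expr_int_mulrn.
have hE N t : t \in `[0, 2 * pi] -> rnorm (E N t) <= r^-1 ^+ N * (M * K).
  move=> ht; rewrite rnormZ rnorm_polar ?exprn_ge0 ?(ltW q0)//.
  rewrite ler_wpM2l ?exprn_ge0 ?(ltW q0)// (le_trans (hM _ _))// ler_wpM2l//.
  exact: hK.
have geo N : (r ^+ 2 - 1) * \sum_(n < N) (r^-1 ^+ n.+1) ^+ 2 <= 1.
  suff -> : (r ^+ 2 - 1) * \sum_(n < N) (r^-1 ^+ n.+1) ^+ 2 = 1 - (r^-1 ^+ N) ^+ 2.
    by rewrite lerBlDr lerDl sqr_ge0.
  elim: N => [|N ih]; first by rewrite big_ord0 mulr0 expr0 expr1n subrr.
  rewrite big_ord_recr/= mulrDr ih [r^-1 ^+ N.+1]exprS; set u := r^-1 ^+ N.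
  by field; rewrite gt_eqF.
have cS N : continuous (fun t : R => rnorm (S N t) ^+ 2).
  exact: (@parseval_continuous N (fun n => r^-1 ^+ n.+1) (fun n => (- s) * n.+1%:Z)
    (fun n => iter n T x)).
have intS N : (r ^+ 2 - 1) * circle_integral (fun t => rnorm (S N t) ^+ 2) <=
    2 * pi * M ^+ 2 * rnorm x ^+ 2.
  rewrite (@parseval N (fun n => r^-1 ^+ n.+1) (fun n => (- s) * n.+1%:Z)
             (fun n => iter n T x)); last first.
    have ns0 : - s != 0 by rewrite oppr_eq0.
    by move=> m n /(mulfI ns0) [].
  rewrite mulrCA -[leRHS]mulrA ler_wpM2l ?mulr_ge0 ?(ltW pi0)//.
  rewrite -exprMn.
  apply: (@le_trans _ _ ((r ^+ 2 - 1) * ((\sum_(n < N) (r^-1 ^+ n.+1) ^+ 2) * (M * rnorm x) ^+ 2))).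
    rewrite ler_wpM2l ?(ltW r21)// mulr_suml; apply: ler_sum => n _.
    rewrite ler_wpM2l ?sqr_ge0// lerXn2r ?nnegrE ?rnorm_ge0//.
    by rewrite mulr_ge0 ?rnorm_ge0.
  by rewrite mulrA ler_piMl ?sqr_ge0.
apply/ler_addgt0Pr => e e0.
(* The pointwise error 2 K r^-N M K, integrated over length 2 pi and multiplied by r^2 - 1, is (B -
   1) r^-N; the 1 keeps [B] positive. *)
pose B := 4 * pi * (r ^+ 2 - 1) * (K * (M * K)) + 1.
have B0 : 0 < B.
  by rewrite ltr_wpDl// !mulr_ge0 ?(ltW pi0) ?(ltW r21).
have q01 : 0 <= r^-1 < 1 by rewrite ltW.
have [N hN] := geometric_small q01 (divr_gt0 e0 B0).
have {}hN := hN N (leqnn N).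
apply: (@le_trans _ _ ((r ^+ 2 - 1) * circle_integral
    (fun t => rnorm (S N t) ^+ 2 + 2 * K * (r^-1 ^+ N * (M * K))))).
  rewrite ler_wpM2l ?(ltW r21)//; apply: circle_integral_le => //.
    by move=> t; apply: cvgD; [exact: cS|exact: cvg_cst].
  move=> t ht; have h1 := hE N t ht; have h2 := hK t ht.
  have h3 : rnorm (V t) <= rnorm (S N t) + rnorm (E N t).
    by rewrite {1}(VSE N t) rnormD.
  have h4 := rnorm_ge0 (V t); have h5 := rnorm_ge0 (S N t); have h6 := rnorm_ge0 (E N t).
  have h7 : rnorm (V t) * rnorm (E N t) <= K * (r^-1 ^+ N * (M * K)) by exact: ler_pM.
  (* Both cases give |V|^2 <= |S|^2 + 2 |V| |E|; |V| - |E| can be squared only when it is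
     nonnegative. *)
  have [h8|h8] := lerP (rnorm (V t)) (rnorm (E N t)).
    have : rnorm (V t) ^+ 2 <= rnorm (V t) * rnorm (E N t) by rewrite expr2 ler_wpM2l.
    have := sqr_ge0 (rnorm (S N t)); have : 0 <= rnorm (V t) * rnorm (E N t) by rewrite mulr_ge0.
    lra.
  have h9 : (rnorm (V t) - rnorm (E N t)) ^+ 2 <= rnorm (S N t) ^+ 2.
    by rewrite lerXn2r ?nnegrE// ?subr_ge0 ?(ltW h8)// lerBlDr.
  have := sqr_ge0 (rnorm (E N t)); nra.
rewrite circle_integralD; [|exact: cS|by move=> t; exact: cvg_cst].
rewrite mulrDr lerD// circle_integral_cst.
apply: (@le_trans _ _ (B * r^-1 ^+ N)); last first.
  by rewrite mulrC -ler_pdivlMr.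
have u0 : 0 <= r^-1 ^+ N by rewrite exprn_ge0// ltW.
rewrite [leRHS]mulrDl mul1r [leLHS](_ : _ = 4 * pi * (r ^+ 2 - 1) * (K * (M * K)) * r^-1 ^+ N).
  by rewrite lerDl.
ring.
Qed.

End Parseval.

(** * The three implications *)

Section NormContinuous.
Variable R : realType.

Definition norm_continuous (X : normedModType R[i]) (V : R -> X) : Prop :=
  forall t e : R, 0 < e -> \forall s \near t, rnorm (V t - V s) <= e.

Lemma continuous_rnorm (X : normedModType R[i]) (V : R -> X) :
  norm_continuous V -> continuous (fun t : R => rnorm (V t)).
Proof.
move=> cV t; apply/cvgrPdist_le => e e0; near=> s.
apply: (le_trans (rnorm_dist_dist _ _)).
by near: s; exact: cV.
Unshelve. all: by end_near. Qed.

Lemma dot_norm_continuous (H : completeNormedModType R[i])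
    (dot : {dot H for Num.conj}) (V W : R -> H) : hilbert_dot dot ->
  norm_continuous V -> norm_continuous W ->
  norm_continuous (fun t => dot (V t) (W t) : R[i]^o).
Proof.
move=> hdot cV cW t e e0.
have w1 : 0 < rnorm (W t) + 1 by rewrite ltr_wpDl// rnorm_ge0.
have v1 : 0 < rnorm (V t) + 1 by rewrite ltr_wpDl// rnorm_ge0.
have d1 : 0 < e / (2 * (rnorm (W t) + 1)) by rewrite divr_gt0// mulr_gt0.
have d2 : 0 < e / (2 * (rnorm (V t) + 1)) by rewrite divr_gt0// mulr_gt0.
near=> s.
have h0 : rnorm (V t - V s) <= 1 by near: s; exact: cV.
have h1 : rnorm (V t - V s) <= e / (2 * (rnorm (W t) + 1)) by near: s; exact: cV.
have h2 : rnorm (W t - W s) <= e / (2 * (rnorm (V t) + 1)) by near: s; exact: cW.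
have -> : dot (V t) (W t) - dot (V s) (W s) =
    dot (V t - V s) (W t) + dot (V s) (W t - W s).
  by rewrite dotBl dotBr addrA subrK.
rewrite (le_trans (rnormD _ _))// [leRHS](splitr e) lerD//.
  rewrite (le_trans (cauchy_schwarz hdot _ _))//.
  rewrite (le_trans (_ : _ <= rnorm (V t - V s) * (rnorm (W t) + 1)))//.
    by rewrite ler_wpM2l ?rnorm_ge0// lerDl.
  by rewrite -ler_pdivlMr// -mulrA -invfM.
rewrite (le_trans (cauchy_schwarz hdot _ _))//.
rewrite (le_trans (_ : _ <= (rnorm (V t) + 1) * rnorm (W t - W s)))//.
  rewrite ler_wpM2r ?rnorm_ge0//.
  rewrite -(subrK (V t) (V s)) addrC (le_trans (rnormD _ _))// lerD2l.
  by rewrite rnorm_distC.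
by rewrite mulrC -ler_pdivlMr// -mulrA -invfM.
Unshelve. all: by end_near. Qed.

End NormContinuous.

Section Equivalence.
Variables (R : realType) (H : completeNormedModType R[i]).
Variables (dot : {dot H for Num.conj}).
Hypothesis hdot : hilbert_dot dot.
Variable T : H -> H.
Hypotheses (bT : bounded_operator T) (hspec : spectrum T `<=` closed_unit_disc R).
Implicit Types (r t : R) (x y : H).

Let lT : linear T := proj1 bT.
Local Notation Rs r t := (resolvent (polar r t) T).
Local Notation Ra r t := (adjoint dot (resolvent (polar r t) T)).

Let polar_gt1 r t : 1 < r -> 1 < rnorm (polar r t : R[i]^o).
Proof. by move=> r1; rewrite rnorm_polar// ltW// (lt_trans _ r1). Qed.

Let bR r t : 1 < r -> bounded_operator (Rs r t).
Proof. by move=> r1; apply: resolvent_bounded => //; exact: polar_gt1. Qed.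

Lemma resolvent_norm_continuous r x : 1 < r -> norm_continuous (fun t => Rs r t x).
Proof.
move=> r1 t e e0.
have x1 : 0 < rnorm x + 1 by rewrite ltr_wpDl// rnorm_ge0.
have d0 : 0 < e / (rnorm x + 1) by rewrite divr_gt0.
apply: filterS (resolvent_near hspec t r1 d0) => s /(_ x) /le_trans; apply.
by rewrite mulrAC ler_pdivrMr// ler_wpM2l ?(ltW e0)// lerDl.
Qed.

Lemma adjoint_norm_continuous r y : 1 < r -> norm_continuous (fun t => Ra r t y).
Proof.
move=> r1 t e e0.
have y1 : 0 < rnorm y + 1 by rewrite ltr_wpDl// rnorm_ge0.
have d0 : 0 < e / (rnorm y + 1) by rewrite divr_gt0.
apply: filterS (resolvent_near hspec t r1 d0) => s hs.
have [_ h1] := adjointP hdot (bR t r1); have [_ h2] := adjointP hdot (bR s r1).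
have h3 x z : dot (Rs r t x - Rs r s x) z = dot x (Ra r t z - Ra r s z).
  by rewrite dotBl dotBr h1 h2.
apply: (le_trans (adjoint_bound hdot (ltW d0) hs h3 y)).
by rewrite mulrAC ler_pdivrMr// ler_wpM2l ?(ltW e0)// lerDl.
Qed.

Lemma power_bounded_square_integrals : power_bounded T ->
  exists2 C : R, 0 < C &
    forall r, 1 < r ->
    (forall x, (r ^+ 2 - 1) * circle_integral (fun t => rnorm (Rs r t x) ^+ 2) <=
       C * rnorm x ^+ 2) /\
    (forall y, (r ^+ 2 - 1) * circle_integral (fun t => rnorm (Ra r t y) ^+ 2) <=
       C * rnorm y ^+ 2).
Proof.
move=> /(power_boundedP bT)[M M0 hM].
have pi0 := pi_gt0 R.
exists (2 * pi * M ^+ 2 + 1).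
  by rewrite ltr_wpDl// !mulr_ge0 ?sqr_ge0// ltW.
move=> r r1; have [K K0 hK] := resolvent_circle_bounded hspec r1.
split=> [x|y].
  rewrite [leRHS]mulrDl ler_wpDr ?mul1r ?sqr_ge0//.
  apply: (circle_square_bound hdot (T := T) (K := K * rnorm x) (s := 1)) => //.
  - by rewrite mulr_ge0// rnorm_ge0.
  - by move=> t; rewrite mul1r resolventE//; exact: polar_gt1.
  - by move=> t ht; exact: hK.
  - by apply: continuous_rnorm; exact: resolvent_norm_continuous.
have [bTa hTa] := adjointP hdot bT.
rewrite [leRHS]mulrDl ler_wpDr ?mul1r ?sqr_ge0//.
apply: (circle_square_bound hdot (T := adjoint dot T) (K := K * rnorm y) (s := -1)) => //.
- exact: (proj1 bTa).
- move=> n; apply: (adjoint_bound hdot M0 (hM n)) => x z.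
  by elim: n x z => //= n ih x z; rewrite hTa ih -iterSr.
- by rewrite mulr_ge0// rnorm_ge0.
(* Tested against every [x], this is the resolvent equation of [T] moved across the inner product,
   which conjugates re^{it} into re^{-it}. *)
- move=> t; rewrite mulN1r; apply: (dot_injr hdot) => x.
  have [_ hR] := adjointP hdot (bR t r1).
  rewrite dotZr dotDr -hTa -!hR -dotDl resolvent_comm//; last exact: polar_gt1.
  rewrite -resolventE//; last exact: polar_gt1.
  by rewrite dotZl conj_complex /polar/= cosN sinN mulrN opprK.
- move=> t ht; have [_ hR] := adjointP hdot (bR t r1).
  apply: (adjoint_bound hdot K0 _ hR) => z; exact: hK.
- by apply: continuous_rnorm; exact: adjoint_norm_continuous.
Qed.

Lemma square_integrals_GFS (C : R) : 0 < C ->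
  (forall r, 1 < r ->
    (forall x, (r ^+ 2 - 1) * circle_integral (fun t => rnorm (Rs r t x) ^+ 2) <=
       C * rnorm x ^+ 2) /\
    (forall y, (r ^+ 2 - 1) * circle_integral (fun t => rnorm (Ra r t y) ^+ 2) <=
       C * rnorm y ^+ 2)) ->
  GFS_operator T.
Proof.
move=> C0 hC; split=> //; exists C => // r r1 x f bf.
have [y fE] := riesz_representation hdot bf.
have yf : rnorm y <= opnorm f.
  have [y0|y0] := eqVneq (rnorm y) 0; first by rewrite y0 opnorm_ge0.
  have yp : 0 < rnorm y by rewrite lt_def y0 rnorm_ge0.
  rewrite -(ler_pM2r yp) -expr2; apply: le_trans (opnorm_ub y bf).
  by rewrite fE dotxx// rnorm_real ger0_norm// sqr_ge0.
have [hx hy] := hC r r1; have {}hx := hx x; have {}hy := hy y.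
have fF t : rnorm (f (iter 2 (Rs r t) x)) = rnorm (dot (Rs r t x) (Ra r t y) : R[i]^o).
  by rewrite fE/=; have [_ ->] := adjointP hdot (bR t r1).
have cF : continuous (fun t : R => rnorm (f (iter 2 (Rs r t) x))).
  rewrite (funext fF); apply: continuous_rnorm; apply: dot_norm_continuous => //.
    exact: resolvent_norm_continuous.
  exact: adjoint_norm_continuous.
have ca : continuous (fun t : R => rnorm (Rs r t x) ^+ 2).
  by apply/continuous_sqr/continuous_rnorm; exact: resolvent_norm_continuous.
have cb : continuous (fun t : R => rnorm (Ra r t y) ^+ 2).
  by apply/continuous_sqr/continuous_rnorm; exact: adjoint_norm_continuous.
rewrite circle_integralE// lee_fin expr1.
have r21 : 0 < (r + 1) * (r - 1) by rewrite mulr_gt0 ?subr_gt0// ltr_wpDl// ltW// (lt_trans _ r1).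
have er : r ^+ 2 - 1 = (r + 1) * (r - 1) by ring.
rewrite er in hx hy.
apply: (@le_trans _ _ (C / ((r + 1) * (r - 1)) * rnorm x * rnorm y)); last first.
  by rewrite ler_wpM2l// mulr_ge0 ?rnorm_ge0// divr_ge0// ltW.
have pt t : rnorm (f (iter 2 (Rs r t) x)) <= rnorm (Rs r t x) * rnorm (Ra r t y).
  by rewrite fF cauchy_schwarz.
have [x0|x0] := eqVneq (rnorm x) 0.
  rewrite x0 mulr0 mul0r -[leRHS](mulr0 (2 * pi)) -circle_integral_cst.
  apply: circle_integral_le => //; first by move=> t; exact: cvg_cst.
  move=> t _; rewrite (le_trans (pt t))// (rnorm_eq0 x0) lin0 ?rnorm0 ?mul0r//.
  exact: (proj1 (bR t r1)).
have [y0|y0] := eqVneq (rnorm y) 0.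
  rewrite y0 mulr0 -[leRHS](mulr0 (2 * pi)) -circle_integral_cst.
  apply: circle_integral_le => //; first by move=> t; exact: cvg_cst.
  by move=> t _; rewrite fE (rnorm_eq0 y0) linear0r rnorm0.
have xp : 0 < rnorm x by rewrite lt_def x0 rnorm_ge0.
have yp : 0 < rnorm y by rewrite lt_def y0 rnorm_ge0.
set a := rnorm x in x0 xp hx *; set b := rnorm y in y0 yp hy *.
(* Cauchy-Schwarz for the integral in the form of a weighted inequality u v <= (b/2a) u^2 + (a/2b)
   v^2. With a = |x| and b = |y| the two terms have equal bounds, so the constant [C] is kept; the
   cases a = 0 and b = 0 were removed above. *)
apply: (@le_trans _ _ (circle_integral (fun t => b / (2 * a) * rnorm (Rs r t x) ^+ 2 +
    a / (2 * b) * rnorm (Ra r t y) ^+ 2))).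
  apply: circle_integral_le => //.
    by move=> t; apply: cvgD; (apply: cvgM; [exact: cvg_cst|]); [exact: ca|exact: cb].
  move=> t _; apply: (le_trans (pt t)); set u := rnorm _; set v := rnorm _.
  rewrite -subr_ge0.
  have -> : b / (2 * a) * u ^+ 2 + a / (2 * b) * v ^+ 2 - u * v =
    (b * u - a * v) ^+ 2 / (2 * a * b).
    by field; rewrite x0 y0.
  by rewrite divr_ge0 ?sqr_ge0// !mulr_ge0// ltW.
have cZ (c : R) (g : R -> R) : continuous g -> continuous (fun t => c * g t).
  by move=> cg t; apply: cvgM; [exact: cvg_cst|exact: cg].
rewrite circle_integralD ?circle_integralZ//; try exact: cZ.
rewrite mulrC -ler_pdivlMr// in hx; rewrite mulrC -ler_pdivlMr// in hy.
have -> : C / ((r + 1) * (r - 1)) * a * b =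
    b / (2 * a) * (C * a ^+ 2 / ((r + 1) * (r - 1))) +
    a / (2 * b) * (C * b ^+ 2 / ((r + 1) * (r - 1))).
  have r1n : r - 1 != 0 by rewrite subr_eq0 gt_eqF.
  have r1p : r + 1 != 0 by rewrite gt_eqF// ltr_wpDl// ltW// (lt_trans _ r1).
  by field; rewrite x0 y0 r1n r1p.
by apply: lerD; rewrite ler_wpM2l// divr_ge0// ?mulr_ge0// ltW.
Qed.

Let cF r x y : 1 < r -> continuous (fun t : R => rnorm (dot (Rs r t (Rs r t x)) y : R[i]^o)).
Proof.
move=> r1; rewrite (_ : (fun t => _) =
    fun t => rnorm (dot (Rs r t x) (Ra r t y) : R[i]^o)); last first.
  by apply/funext => t; have [_ ->] := adjointP hdot (bR t r1).
apply: continuous_rnorm; apply: dot_norm_continuous => //.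
  exact: resolvent_norm_continuous.
exact: adjoint_norm_continuous.
Qed.

(* The left-hand side is, up to a factor [r ^+ (n + 2)], the Fourier
   coefficient of index [-(n + 2)] of [t |-> <R(re^{it}, T)^2 x, y>]. *)
Lemma resolvent_sqr_fourier_le r n x y : 1 < r ->
  2 * pi * (n.+1%:R * r^-1 ^+ n.+2 * complex.Re (dot (iter n T x) y)) <=
  circle_integral (fun t => rnorm (dot (Rs r t (Rs r t x)) y : R[i]^o)).
Proof.
move=> r1; have r0 : 0 < r by rewrite (lt_trans _ r1).
have q0 : 0 < r^-1 by rewrite invr_gt0.
have q1 : r^-1 < 1 by rewrite invf_lt1.
have pi0 := pi_gt0 R.
set F := fun t => rnorm _.
(* One factor (1 + d)^N pays for the growth of T^N, the other for the factor N + 1 in the remainder,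
   through Bernoulli and [d <= 1]. The remainder then decays like [z ^+ N] with z = (1 + d)^2 / r <
   1. *)
have [d d0 [d1 dr]] : exists2 d : R, 0 < d & d <= 1 /\ (1 + d) ^+ 2 < r.
  exists (Num.min 1 ((r - 1) / 4)).
    by rewrite lt_min ltr01/= divr_gt0// subr_gt0.
  have h1 : Num.min 1 ((r - 1) / 4) <= 1 by rewrite ge_min lexx.
  have h2 : Num.min 1 ((r - 1) / 4) <= (r - 1) / 4 by rewrite ge_min lexx orbT.
  have h3 : 0 < Num.min 1 ((r - 1) / 4) by rewrite lt_min ltr01/= divr_gt0// subr_gt0.
  by split=> //; nra.
have bern N : N.+1%:R * d <= (1 + d) ^+ N.
  suff : 1 + N%:R * d <= (1 + d) ^+ N by apply: le_trans; rewrite -natr1 mulrDl mul1r addrC lerD2r.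
  elim: N => [|N ih]; first by rewrite mul0r addr0 expr0.
  rewrite exprS; have : 0 <= N%:R * d by rewrite mulr_ge0// ltW.
  rewrite -natr1; nra.
have d1' : 1 < 1 + d by rewrite ltrDl.
have [K K0 hK] := power_growth_gt1 bT hspec d1'.
have [L L0 hL] := resolvent_circle_bounded hspec r1.
pose z := r^-1 * (1 + d) ^+ 2.
have z01 : 0 <= z < 1.
  by rewrite /z mulr_ge0 ?sqr_ge0 ?(ltW q0)//= mulrC ltr_pdivrMr// mul1r.
pose B := K * (L ^+ 2 + L) / d * rnorm x * rnorm y.
have B0 : 0 <= B.
  by rewrite !mulr_ge0 ?rnorm_ge0 ?invr_ge0 ?(ltW d0)// addr_ge0// sqr_ge0.
pose w t := polar r^-1 (- t).
pose U t := Rs r t (Rs r t x).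
pose E N t := w t ^+ N *: iter N T (U t + (N%:R * w t) *: Rs r t x).
have UE N t : U t = \sum_(k < N) (k.+1%:R * w t ^+ k.+2) *: iter k T x + E N t.
  have hw v : Rs r t v = w t *: (v + T (Rs r t v)).
    rewrite -resolventE//; last exact: polar_gt1.
    by rewrite scalerA /w polarM mulVf ?gt_eqF// addNr polar0 scale1r.
  exact: (neumann_expansion2 lT N (hw x) (hw (Rs r t x))).
have rw t : rnorm (w t : R[i]^o) = r^-1 by rewrite rnorm_polar// ltW.
have hE N t : t \in `[0, 2 * pi] -> rnorm (dot (E N t) y : R[i]^o) <= z ^+ N * B.
  move=> ht; rewrite (le_trans (cauchy_schwarz hdot _ _))//.
  rewrite /B mulrA ler_wpM2r ?rnorm_ge0//.
  rewrite rnormZ rnormcX rw (le_trans (ler_wpM2l (exprn_ge0 N (ltW q0)) (hK N _)))//.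
  have hV := hL t x ht; have hU := hL t (Rs r t x) ht.
  have x0 := rnorm_ge0 x; have N0 : (0 : R) <= N%:R by [].
  have h1 : rnorm (U t + (N%:R * w t) *: Rs r t x) <=
      (L ^+ 2 + L) * N.+1%:R * rnorm x.
    rewrite (le_trans (rnormD _ _))// rnormZ rnormcM rw.
    rewrite -(rmorph_nat (real_complex R)) rnorm_real ger0_norm//.
    have h2 : rnorm (U t) <= L ^+ 2 * rnorm x.
      by rewrite (le_trans hU)// expr2 -mulrA ler_wpM2l.
    have h3 : N%:R * r^-1 * rnorm (Rs r t x) <= N%:R * (L * rnorm x).
      rewrite -mulrA ler_wpM2l// (le_trans _ hV)// ler_piMl ?rnorm_ge0//.
      exact: ltW.
    rewrite (le_trans (lerD h2 h3))// -natr1.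
    have : 0 <= L * rnorm x by rewrite mulr_ge0.
    have : 0 <= L ^+ 2 * N%:R * rnorm x by rewrite !mulr_ge0 ?sqr_ge0.
    lra.
  have c0 : 0 <= r^-1 ^+ N * (K * (1 + d) ^+ N).
    by rewrite !mulr_ge0 ?exprn_ge0 ?(ltW q0)// addr_ge0// ltW.
  rewrite mulrA (le_trans (ler_wpM2l c0 h1))//.
  have h4 : N.+1%:R <= (1 + d) ^+ N / d by rewrite ler_pdivlMr.
  have -> : z ^+ N * (K * (L ^+ 2 + L) / d * rnorm x) =
      r^-1 ^+ N * (K * (1 + d) ^+ N) * ((L ^+ 2 + L) * ((1 + d) ^+ N / d) * rnorm x).
    by rewrite /z exprMn -exprM mulnC exprM expr2; ring.
  rewrite ler_wpM2l// ler_wpM2r// ler_wpM2l//.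
  by rewrite addr_ge0// sqr_ge0.
(* The truncated series multiplied by e^{i(n+2)t}, which moves the wanted term [k = n] to frequency
   0. The factor has modulus 1, so the real part stays below [F] up to the remainder. *)
pose P N t := \sum_(k < N) complex.Re (polar 1 ((n%:Z - k%:Z)%:~R * t) *
   ((k.+1%:R * r^-1 ^+ k.+2)%:C * dot (iter k T x) y)).
have cP N : continuous (P N) by apply: continuous_sum => k; exact: continuous_trig.
have PE N t : P N t = complex.Re (polar 1 (n.+2%:R * t) * dot (U t - E N t) y).
  rewrite (UE N t) addrK dot_suml mulr_sumr Re_sum; apply: eq_bigr => k _.
  rewrite dotZl [in LHS]mulrA [in RHS]mulrA; congr (complex.Re (_ * _)).
  rewrite /w polarX -(rmorph_nat (real_complex R) k.+1) polar_real polarM mul1r.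
  rewrite mulrC polar_real mulr1; congr polar.
  by rewrite -[_ *+ _]mulr_natr -!natr1 rmorphB/=; ring.
have PF N t : t \in `[0, 2 * pi] -> P N t <= F t + z ^+ N * B.
  move=> ht; rewrite PE (le_trans (Re_le_rnorm _))// rnormcM rnorm_polar// mul1r.
  by rewrite dotBl (le_trans (rnormB _ _))// lerD2l hE.
have cFr : continuous F by exact: cF.
have intP N : (n < N)%N -> circle_integral (P N) =
    2 * pi * (n.+1%:R * r^-1 ^+ n.+2 * complex.Re (dot (iter n T x) y)).
  move=> nN; rewrite circle_integral_sum => [|k]; last exact: continuous_trig.
  under eq_bigr => k _ do rewrite circle_integral_trig subr_eq0.
  rewrite (bigD1 (Ordinal nN))//= eqxx big1 ?addr0 => [|k kn]; last first.
    rewrite (_ : (n%:Z == k%:Z) = false)//; apply/negbTE.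
    by apply: contra kn => /eqP[nk]; apply/eqP/val_inj.
  by rewrite ReM_real.
apply/ler_addgt0Pr => e e0.
have e1 : 0 < e / (2 * pi * (B + 1)) by rewrite divr_gt0// !mulr_gt0// ltr_wpDl.
have [N0 hN0] := geometric_small z01 e1.
pose N := maxn N0 n.+1.
have {}hN0 := hN0 N (leq_maxl _ _).
rewrite -(@intP N) ?leq_maxr//.
apply: (le_trans (circle_integral_le (cP N) _ (PF N))).
  by move=> t; apply: cvgD; [exact: cFr|exact: cvg_cst].
rewrite circle_integralD//; last by move=> t; exact: cvg_cst.
rewrite lerD2l circle_integral_cst.
move: hN0; rewrite ler_pdivlMr ?mulr_gt0// ?ltr_wpDl//; apply: le_trans.
have z0 : 0 <= z ^+ N by rewrite exprn_ge0//; case/andP: z01.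
have -> : 2 * pi * (z ^+ N * B) = z ^+ N * (2 * pi * B) by ring.
by rewrite ler_wpM2l// ler_wpM2l ?mulr_ge0 ?(ltW pi0)// lerDl.
Qed.

Lemma GFS_power_bounded : GFS_operator T -> power_bounded T.
Proof.
move=> [_ [C C0 hC]]; apply/(power_boundedP bT).
exists (C * expR 1); first by rewrite mulr_ge0 ?expR_ge0// ltW.
move=> n x; set y := iter n T x.
have [y0|yn] := eqVneq (rnorm y) 0.
  by rewrite y0 !mulr_ge0 ?rnorm_ge0 ?expR_ge0// ltW.
have yp : 0 < rnorm y by rewrite lt_def yn rnorm_ge0.
have m0 : (0 : R) < n.+1%:R by [].
(* Then 1 / (r - 1) = n + 1 cancels the factor n + 1 of the Fourier coefficient, while r^(n+2) = r
   (1 + 1/(n+1))^(n+1) <= 2 e stays bounded. *)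
pose r : R := 1 + n.+1%:R^-1.
have r1 : 1 < r by rewrite ltrDl invr_gt0.
have r0 : 0 < r by rewrite (lt_trans _ r1).
have r2 : r <= 2 by rewrite /r -[leRHS]/(1 + 1) lerD2l invf_le1// ler1n.
have rn : r ^+ n.+2 <= 2 * expR 1.
  rewrite exprS; apply: ler_pM => //; [exact: ltW|by rewrite exprn_ge0// ltW|].
  have -> : expR 1 = expR (n.+1%:R^-1) ^+ n.+1 :> R.
    by rewrite -expRM_natl divff// gt_eqF.
  by rewrite lerXn2r ?nnegrE ?expR_ge0 ?(ltW r0)// expR_ge1Dx.
have bf := dot_bounded_functional hdot y.
have h1 := resolvent_sqr_fourier_le n x y r1.
have := hC r r1 x _ bf; rewrite /= circle_integralE ?lee_fin; last exact: cF.
rewrite expr1 => /(le_trans h1); rewrite -/y dotxx//=.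
have x0 := rnorm_ge0 x; have pi2 := pi_ge2 R.
move=> h2.
have h3 : 2 * pi * (n.+1%:R * r^-1 ^+ n.+2 * rnorm y ^+ 2) <=
    C / ((r + 1) * (r - 1)) * rnorm x * rnorm y.
  apply: (le_trans h2); rewrite ler_wpM2l ?opnorm_dot_le//.
  by rewrite mulr_ge0// divr_ge0 ?mulr_ge0 ?subr_ge0 ?addr_ge0// ltW.
have h4 : 2 * pi * (n.+1%:R * r^-1 ^+ n.+2 * rnorm y) <=
    C / ((r + 1) * (r - 1)) * rnorm x.
  by rewrite -(ler_pM2r yp); move: h3; rewrite expr2 !mulrA.
have rm : r - 1 = n.+1%:R^-1 by rewrite /r addrC addKr.
have h5 : 2 * pi * (r + 1) * rnorm y <= C * r ^+ n.+2 * rnorm x.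
  have u0 : 0 < r ^+ n.+2 by rewrite exprn_gt0.
  have p0 : 0 < r + 1 by rewrite addr_gt0.
  move: h4; rewrite exprVn rm.
  set u := r ^+ n.+2 in u0 *; set p := r + 1 in p0 *; set m := n.+1%:R in m0 *.
  have c0 : 0 < p / m * u by rewrite mulr_gt0// divr_gt0.
  rewrite -(ler_pM2l c0).
  have -> : p / m * u * (2 * pi * (m / u * rnorm y)) = 2 * pi * p * rnorm y.
    by field; rewrite !gt_eqF.
  suff -> : p / m * u * (C / (p / m) * rnorm x) = C * u * rnorm x by [].
  by field; rewrite !gt_eqF.
have h6 : C * r ^+ n.+2 * rnorm x <= C * (2 * expR 1) * rnorm x.
  by rewrite ler_wpM2r// ler_wpM2l// ltW.
have h7 : 2 * rnorm y <= 2 * pi * (r + 1) * rnorm y.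
  rewrite ler_wpM2r ?rnorm_ge0//; nra.
rewrite -(ler_pM2l (ltr0n R 2)); lra.
Qed.

End Equivalence.

Theorem corollary2p13 (R : realType) (H : completeNormedModType R[i])
    (dot : {dot H for Num.conj}) (hdot : hilbert_dot dot)
    (T : H -> H) (hT : bounded_operator T)
    (hspec : spectrum T `<=` closed_unit_disc R) :
  [<-> power_bounded T;
       exists2 C : R, 0 < C &
         forall r : R, 1 < r ->
           (forall x : H,
             ((r ^+ 2 - 1)%:E *
                \int[lebesgue_measure]_(t in `[0%R, (2 * pi)%R])
                  (rnorm (resolvent (polar r t) T x) ^+ 2)%:E <=
              (C * rnorm x ^+ 2)%:E)%E) /\
           (forall y : H,
             ((r ^+ 2 - 1)%:E *
                \int[lebesgue_measure]_(t in `[0%R, (2 * pi)%R])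
                  (rnorm (adjoint dot (resolvent (polar r t) T) y) ^+ 2)%:E <=
              (C * rnorm y ^+ 2)%:E)%E);
       GFS_operator T].
Proof.
have cR r x : 1 < r -> continuous (fun t : R => rnorm (resolvent (polar r t) T x) ^+ 2).
  by move=> r1; apply/continuous_sqr/continuous_rnorm; exact: resolvent_norm_continuous.
have cA r y : 1 < r ->
    continuous (fun t : R => rnorm (adjoint dot (resolvent (polar r t) T) y) ^+ 2).
  by move=> r1; apply/continuous_sqr/continuous_rnorm; exact: adjoint_norm_continuous.
tfae.
- move=> /(power_bounded_square_integrals hdot hT hspec)[C C0 hC]; exists C => // r r1.
  by split=> [x|y]; rewrite circle_integralE ?lee_fin; [exact: (hC r r1).1|exact: cR|
    exact: (hC r r1).2|exact: cA].
- move=> [C C0 hC]; apply: (square_integrals_GFS hdot hspec C0) => r r1.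
  have [hx hy] := hC r r1; split=> [x|y].
    by have := hx x; rewrite circle_integralE ?lee_fin//; exact: cR.
  by have := hy y; rewrite circle_integralE ?lee_fin//; exact: cA.
- exact: GFS_power_bounded.
Qed.
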